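(* Let $\mathfrak g$ be a complex semi-simple Lie algebra with adjoint group $\mathbf G$, let $x\in\mathfrak g$ be any element, $\mathbf G\cdot x$ its adjoint orbit and $x=s+e$ its Jordan-Chevalley decomposition ($s$ semi-simple, $e$ nilpotent, $[s,e]=0$). Let $\mathfrak n_e$ be any complement of $\mathfrak g(x)$ in $\mathfrak g(s)$, and put $\mathfrak n:=\mathfrak n_s\oplus\mathfrak n_e$, where $\mathfrak n_s:=\mathfrak g(s)^\perp$. Then the parallel affine spaces $N_x:=x+\mathfrak n^\perp$ and $N:=e+\mathfrak n^\perp$ are, respectively, transverse slices to the adjoint orbit $\mathbf G\cdot x$ in $\mathfrak g$ (at $x$) and to the nilpotent orbit $\mathbf G(s)\cdot e$ in $\mathfrak g(s)$ (at $e$). Moreover, the transverse Poisson structures on both transverse slices are given by the same Poisson matrix, namely $$A(n)+B_e(n)\,C_e(n)^{-1}\,B_e(n)^{\top},$$ in terms of the same affine coordinates $q_1,\dots,q_k$ restricted to the corresponding transverse slice ($n$ denoting a point of $N_x$, respectively of $N$, and the two slices being identified by the translation $N_x=s+N$).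
   Context: $\langle\cdot|\cdot\rangle$ is the Killing form of $\mathfrak g$, and $\perp$ denotes orthogonal complement in $\mathfrak g$ with respect to it. For $y\in\mathfrak g$, $\mathfrak g(y):=\{z\in\mathfrak g\mid [y,z]=0\}$ is its centralizer; $\mathbf G(s)$ is the centralizer of $s$ in $\mathbf G$, with Lie algebra $\mathfrak g(s)$ (which is reductive and contains $e$). One has $\mathfrak g(x)=\mathfrak g(s)\cap\mathfrak g(e)$, the restriction of $\langle\cdot|\cdot\rangle$ to $\mathfrak g(s)$ is non-degenerate, and $\mathfrak g=\mathfrak g(x)\oplus\mathfrak n_e\oplus\mathfrak n_s$. The Lie-Poisson structure on $\mathfrak g$ is $\{F,G\}(y):=\langle y|[dF(y),dG(y)]\rangle$, where differentials are viewed as elements of $\mathfrak g\cong\mathfrak g^*$ via the Killing form; its symplectic leaves are the adjoint orbits. The Lie-Poisson structure on $\mathfrak g(s)$ is defined by the same formula, using the restriction of $\langle\cdot|\cdot\rangle$ to $\mathfrak g(s)$. A transverse slice at a point $m$ to a symplectic leaf $S$ of a Poisson manifold $M$ is a submanifold $N\ni m$ with $T_mM=T_mS\oplus T_mN$. On a neighbourhood of $m$ in $N$ there is then an induced Poisson structure, the transverse Poisson structure, given by Dirac reduction: if $(q_1,\dots,q_k,q_{k+1},\dots,q_{k+2r})$ are linear coordinates centered at $m$, with $N$ given by $q_{k+1}=\dots=q_{k+2r}=0$, and the Poisson matrix of $M$ is $\begin{pmatrix}A&B\\-B^\top&C\end{pmatrix}$ (with blocks of sizes $k$ and $2r$, $C$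 being invertible near $m$), then the Poisson matrix of the transverse structure in the coordinates $q_1,\dots,q_k$ restricted to $N$ is $A+BC^{-1}B^\top$. Here, let $(Z_1,\dots,Z_k)$ be a basis of $\mathfrak g(x)$ and $(X_1,\dots,X_{2p})$ a basis of $\mathfrak n_e$. The coordinates are $q_i(y):=\langle y-x|Z_i\rangle$ on $N_x$ and $q_i(y):=\langle y-e|Z_i\rangle$ on $N$, $1\le i\le k$, which correspond to each other under the translation $N_x=s+N$. The matrices are $A_{i,j}(n)=\langle n|[Z_i,Z_j]\rangle$ ($1\le i,j\le k$), $B_{e;i,m}(n)=\langle n|[Z_i,X_m]\rangle$ ($1\le i\le k$, $1\le m\le 2p$), $C_{e;l,m}(n)=\langle n|[X_l,X_m]\rangle$ ($1\le l,m\le 2p$). The transverse Poisson structures are considered near the base point, where $C_e$ is invertible. *)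

(* Defs.v *)
From HB Require Import structures.
From mathcomp Require Import all_boot all_order all_algebra.
From mathcomp Require Import complex.
From mathcomp Require Import all_classical all_reals all_analysis.

Set Implicit Arguments.
Unset Strict Implicit.
Unset Printing Implicit Defensive.

Import Order.TTheory GRing.Theory Num.Theory numFieldNormedType.Exports.

Local Open Scope classical_set_scope.
Local Open Scope complex_scope.
Local Open Scope ring_scope.

HB.mixin Record Vector_isLie (F : fieldType) V of Vector F V := {
  lie : V -> V -> V;
  lie_linearl : forall (a : F) (x y z : V),
    lie (a *: x + y) z = a *: lie x z + lie y z;
  lie_linearr : forall (a : F) (x y z : V),
    lie z (a *: x + y) = a *: lie z x + lie z y;
  liexx : forall x : V, lie x x = 0;
  lie_jacobi : forall x y z : V,
    lie x (lie y z) + lie y (lie z x) + lie z (lie x y) = 0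
}.

#[short(type="lieAlgType")]
HB.structure Definition LieAlgebra (F : fieldType) :=
  {V of Vector_isLie F V & Vector F V}.

Section LieAlgebraTheory.
Context {F : fieldType} {g : lieAlgType F}.
Implicit Types (U V M : {vspace g}) (x y s e : g).

Definition ad x : 'End(g) := linfun (lie x).

Definition lfun_trace (f : 'End(g)) : F :=
  \sum_(i < \dim {:g}) coord (vbasis {:g}) i (f (vbasis {:g})`_i).

Definition killing x y : F := lfun_trace (ad x \o ad y)%VF.

Definition centralizer y : {vspace g} := lker (ad y).

Definition killing_orth U : {vspace g} :=
  (\bigcap_(i < \dim U)
     lker (linfun (killing (vbasis U)`_i : g -> F^o)))%VS.

Definition lie_prod U V : {vspace g} :=
  <<[seq lie u v | u <- vbasis U, v <- vbasis V]>>%VS.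

Definition lie_ideal U : Prop := forall x u, u \in U -> lie x u \in U.

Definition lie_solvable U : Prop :=
  exists k, iter k (fun V => lie_prod V V) U = 0%VS.

Definition ad_semisimple s : Prop :=
  exists b : (\dim {:g}).-tuple g, basis_of {:g} b /\
    forall i, exists a : F, lie s (tnth b i) = a *: tnth b i.

Definition ad_nilpotent e : Prop :=
  exists k, forall y, iter k (lie e) y = 0.

Definition jordan_chevalley x s e : Prop :=
  [/\ x = s + e, ad_semisimple s, ad_nilpotent e & lie s e = 0].

Definition bracket_mx (k l : nat) (Z : k.-tuple g) (X : l.-tuple g) (n : g) :
    'M[F]_(k, l) :=
  \matrix_(i, j) killing n (lie (tnth Z i) (tnth X j)).

(* Functions q_i(y) = <y - m | W_i>. *)
Definition killing_coord (m : g) (d : nat) (W : d.-tuple g) (i : 'I_d) (y : g) :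
    F :=
  killing (y - m) (tnth W i).

Definition affine_space (m : g) U : set g := [set m + u | u in [set` U]].

End LieAlgebraTheory.

Definition semisimple (F : fieldType) (g : lieAlgType F) : Prop :=
  forall U : {vspace g}, lie_ideal U -> lie_solvable U -> U = 0%VS.

Section ComplexLieAlgebra.
Context {R : realType} {g : lieAlgType R[i]}.
Implicit Types (M : {vspace g}) (N : set g) (H : set 'End(g)) (m y v w : g).

(* exp D = \sum_k D^k / k!, the limit being taken coordinatewise. *)
Definition lfun_exp (D : 'End(g)) : 'End(g) :=
  linfun (fun v : g => \sum_(i < \dim {:g})
    (lim (series (fun k : nat =>
       (k`!%:R^-1 * coord (vbasis {:g}) i (iter k D v) : R[i]^o)) @ \oo) : R[i])
      *: (vbasis {:g})`_i).

(* The group generated by the exp (ad y). Closure under inverses is automatic,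
   exp (ad (- y)) being the inverse of exp (ad y). *)
Inductive adjoint_group : set 'End(g) :=
| adjoint_group1 : adjoint_group \1%VF
| adjoint_groupM (y : g) (h : 'End(g)) :
    adjoint_group h -> adjoint_group (lfun_exp (ad y) \o h)%VF.

Definition adjoint_stabilizer (s : g) : set 'End(g) :=
  [set h | adjoint_group h /\ h s = s].

Definition group_orbit H m : set g := [set h m | h in H].

(* Lie algebra of a Lie subgroup H of GL(g). *)
Definition group_lie H : set 'End(g) :=
  [set D | forall t : R, H (lfun_exp (t%:C *: D))].

(* Tangent space at m of the orbit of m under H: the image of the differential
   at the identity of the orbit map h |-> h m, which is linear in h. *)
Definition orbit_tangent H m : set g := [set D m | D in group_lie H].

(* N is an affine subspace of M through m, hence a submanifold whose tangent
   space at m is its direction U; T is the tangent space of the orbit. *)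
Definition transverse_slice M H m N : Prop :=
  group_orbit H m `<=` [set` M] /\
  exists T U : {vspace g},
    [/\ [set` T] = orbit_tangent H m, N = affine_space m U,
        (T + U)%VS = M & directv (T + U)].

(* w is the differential at y of the restriction of f to M, seen as an element
   of M through the Killing form. *)
Definition is_gradient M (f : g -> R[i]) y w : Prop :=
  w \in M /\ forall v, v \in M ->
    is_derive (0 : R[i]^o) (1 : R[i]^o)
      (fun t : R[i]^o => f (y + (t : R[i]) *: v) : R[i]^o) (killing w v).

Definition gradient M (f : g -> R[i]) y : g :=
  xget 0 [set w | is_gradient M f y w].

Definition lie_poisson M (f h : g -> R[i]) y : R[i] :=
  killing y (lie (gradient M f y) (gradient M h y)).

Definition poisson_mx M (d : nat) (q : 'I_d -> g -> R[i]) y : 'M[R[i]]_d :=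
  \matrix_(i, j) lie_poisson M (q i) (q j) y.

Definition linear_coordinates M m (d : nat) (q : 'I_d -> g -> R[i]) : Prop :=
  [/\ m \in M,
      forall i, exists phi : 'Hom(g, R[i]^o), forall y, q i y = phi (y - m)
    & forall c : 'I_d -> R[i],
        exists! y, y \in M /\ forall i, q i y = c i].

(* P is, near m, the matrix in the coordinates q_1, ..., q_k of the transverse
   Poisson structure on N obtained by Dirac reduction of the Lie-Poisson
   structure of M. The neighbourhood of m in N is a polydisc in these
   coordinates. *)
Definition transverse_poisson_mx M m N (k l : nat)
    (q : 'I_(k + l) -> g -> R[i]) (P : g -> 'M[R[i]]_k) : Prop :=
  [/\ linear_coordinates M m q,
      N = [set y | y \in M /\ forall j : 'I_l, q (rshift k j) y = 0]
    & exists2 eps : R, 0 < eps &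
        forall n, N n ->
          (forall i : 'I_k, `|q (lshift l i) n| < eps%:C) ->
          let A := ulsubmx (poisson_mx M q n) in
          let B := ursubmx (poisson_mx M q n) in
          let C := drsubmx (poisson_mx M q n) in
          C \in unitmx /\ P n = A + B *m invmx C *m B^T].

End ComplexLieAlgebra.

(* Main.v *)
Require Import Defs.
From HB Require Import structures.
From mathcomp Require Import all_boot all_order all_algebra.
From mathcomp Require Import complex ring.
From mathcomp Require Import all_classical all_reals all_analysis.

Set Implicit Arguments.
Unset Strict Implicit.
Unset Printing Implicit Defensive.

Import Order.TTheory GRing.Theory Num.Theory numFieldNormedType.Exports.
Import passmx.

Local Open Scope classical_set_scope.
Local Open Scope complex_scope.
Local Open Scope ring_scope.

(** The proof has a linear-algebra core and two inputs from Lie theory.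

    Core.  Let [M] be a subalgebra on which the Killing form is non-degenerate,
    [m] a point of [M] and [N] a complement in [M] of the centralizer of [m].  By
    invariance, [<m | [u, v]> = <[m, u] | v>], so the centralizer is the radical of
    this alternating form on [M] and the form is non-degenerate on [N]
    ([bracket_form_nondegenerate]).  Hence its matrix in a basis of [N] is
    invertible, at [m] and then near [m], and the orthogonal complement of [N] in
    [M] is a complement of the tangent space [[m, M]] of the orbit
    ([tangent_complement_sum], [tangent_complement_direct]).  The coordinates being
    affine, their gradients are constant and equal to the basis vectors, so the
    Poisson matrix is a matrix of brackets and [dirac_reduction] applies.

    The core is used for [M = g], [m = x], [N = n_s + n_e] and for [M = g(s)],
    [m = e], [N = n_e].  Both choices are admissible because [g] is the orthogonal
    sum of [g(s)] and [n_s] ([centralizer_orth]) and [g(x)] is the intersection of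
    [g(s)] and [g(e)] ([centralizer_jordan]); they give the same slice up to
    translation by [s] because [n_s] is orthogonal to [g(s)].  Finally, at a point
    [n] of [N_x], which lies in [g(s)], all the products [<n | [u, v]>] with [u] in
    [g(s)] and [v] in [n_s] vanish: the large matrix [C] is block diagonal with
    first block [C_e], [B] is [B_e] followed by zeros, and the second block drops
    out ([schur_row_block]).  Translation by [s] changes nothing, as [s] is
    orthogonal to the brackets of elements of [g(s)] with [g].

    First input: the Killing form of a semisimple Lie algebra is non-degenerate
    ([killing_nondegenerate]).  Its radical [K] is an ideal, and for [x] in [[K, g]]
    the trace of [ad x] against the derivation that acts on each generalized
    eigenspace of [ad x] by the conjugate eigenvalue is both zero and the sum of
    the squared moduli of the eigenvalues.  So [ad x] is nilpotent, and Engel's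
    theorem ([ad_nilpotent_shrinking]) makes [K] solvable, hence zero.

    Second input: the orbits have the expected tangent spaces, that is, the
    operators whose one-parameter group lies in the adjoint group are the [ad y]
    ([group_lie_adjoint]), and those that moreover fix [s] come from the [y] that
    centralize [s] ([group_lie_stabilizer]).  The exponential of a derivation is an
    automorphism ([lfun_exp_automorphism]); conversely, comparing first-order terms
    at the origin shows that a one-parameter group of automorphisms is generated by
    a derivation ([derivation_of_automorphisms]), and derivations are inner
    because the Killing form is non-degenerate ([derivation_inner]). *)

(** * Brackets, traces and the Killing form *)

Section LieBasics.
Context {F : fieldType} {g : lieAlgType F}.
Implicit Types (U V W : {vspace g}) (u v w x y z : g) (f h : 'End(g)).

Lemma lie_is_linear x : linear (lie x : g -> g).
Proof. by move=> a u v; rewrite lie_linearr. Qed.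

HB.instance Definition _ x :=
  GRing.isLinear.Build F g g _ (lie x : g -> g) (lie_is_linear x).

Lemma lieC x y : lie x y = - lie y x.
Proof.
have := liexx (x + y).
rewrite -{1}[x]scale1r lie_linearl scale1r !raddfD /= !liexx.
by rewrite add0r addr0 => /eqP; rewrite addr_eq0 => /eqP.
Qed.

Lemma lieDr x y z : lie z (x + y) = lie z x + lie z y.
Proof. exact: raddfD. Qed.

Lemma lieBr x y z : lie z (x - y) = lie z x - lie z y.
Proof. exact: raddfB. Qed.

Lemma lieNr x z : lie z (- x) = - lie z x.
Proof. exact: raddfN. Qed.

Lemma lieZr a x z : lie z (a *: x) = a *: lie z x.
Proof. exact: linearZ. Qed.

Lemma lie0r z : lie z 0 = 0.
Proof. exact: raddf0. Qed.

Lemma lie_sumr I (r : seq I) (P : pred I) (E : I -> g) z :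
  lie z (\sum_(i <- r | P i) E i) = \sum_(i <- r | P i) lie z (E i).
Proof. exact: raddf_sum. Qed.

Lemma lieDl x y z : lie (x + y) z = lie x z + lie y z.
Proof. by rewrite ![lie _ z]lieC raddfD /= opprD. Qed.

Lemma lieZl a x z : lie (a *: x) z = a *: lie x z.
Proof. by rewrite ![lie _ z]lieC linearZ /= scalerN. Qed.

Lemma lieNl x z : lie (- x) z = - lie x z.
Proof. by rewrite ![lie _ z]lieC raddfN. Qed.

Lemma lieBl x y z : lie (x - y) z = lie x z - lie y z.
Proof. by rewrite lieDl lieNl. Qed.

Lemma lie0l z : lie 0 z = 0.
Proof. by rewrite lieC raddf0 oppr0. Qed.

Lemma lie_suml I (r : seq I) (P : pred I) (E : I -> g) z :
  lie (\sum_(i <- r | P i) E i) z = \sum_(i <- r | P i) lie (E i) z.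
Proof. by rewrite lieC raddf_sum -sumrN; apply: eq_bigr => i _; rewrite -lieC. Qed.

Lemma lie_deriv x y z : lie x (lie y z) = lie (lie x y) z + lie y (lie x z).
Proof.
have := lie_jacobi x y z; rewrite [lie z (lie x y)]lieC [lie z x]lieC raddfN /=.
by move/eqP; rewrite subr_eq0 subr_eq => /eqP.
Qed.

Lemma adE x y : ad x y = lie x y.
Proof. by rewrite /ad lfunE. Qed.

Lemma ad_linear : linear (@ad F g).
Proof.
by move=> a x y; apply/lfunP => z; rewrite add_lfunE scale_lfunE !adE lieDl lieZl.
Qed.

Lemma ad_lie x y : ad (lie x y) = (ad x \o ad y)%VF - (ad y \o ad x)%VF.
Proof.
apply/lfunP => z; rewrite add_lfunE opp_lfunE !comp_lfunE !adE lie_deriv.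
by rewrite addrK.
Qed.

Definition lie_derivation f :=
  forall u v, f (lie u v) = lie (f u) v + lie u (f v).

Lemma ad_derivation f x : lie_derivation f ->
  ad (f x) = (f \o ad x)%VF - (ad x \o f)%VF.
Proof.
move=> DD; apply/lfunP => v; rewrite add_lfunE opp_lfunE !comp_lfunE !adE.
by rewrite DD addrK.
Qed.

Lemma mem_centralizer x y : (y \in centralizer x) = (lie x y == 0).
Proof. by rewrite memv_ker adE. Qed.

Lemma lie_prodP U V W :
  (forall u v, u \in U -> v \in V -> lie u v \in W) <-> (lie_prod U V <= W)%VS.
Proof.
split=> [UVW | /span_subvP UVW u v uU vV].
  by apply/span_subvP => _ /allpairsP[[u v] /= [/vbasis_mem uU /vbasis_mem vV ->]];
     exact: UVW.
rewrite (coord_vbasis uU) (coord_vbasis vV) lie_suml memv_suml // => i _.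
rewrite lieZl memvZ // lie_sumr memv_suml // => j _.
rewrite lieZr memvZ // UVW //; apply/allpairsP.
by exists ((vbasis U)`_i, (vbasis V)`_j); split; rewrite //= mem_nth // size_tuple.
Qed.

Lemma memv_lie_prod U V u v : u \in U -> v \in V -> lie u v \in lie_prod U V.
Proof. by move: u v; apply/lie_prodP/subvv. Qed.

Lemma lie_prodS U U' V V' :
  (U <= U')%VS -> (V <= V')%VS -> (lie_prod U V <= lie_prod U' V')%VS.
Proof.
move=> /subvP sU /subvP sV; apply/lie_prodP => u v /sU uU /sV vV.
exact: memv_lie_prod.
Qed.

Let b := vbasis {:g}.
Let bP : basis_of {:g} b := vbasisP _.
Let bF : free b := basis_free bP.

Lemma lfun_trace_mx f : lfun_trace f = \tr (mxof b b f).
Proof.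
apply: eq_bigr => i _; rewrite /mxof mxE /= vecof_delta -[RHS]coord_rVof.
by [].
Qed.

Lemma lfun_trace_linear : linear (@lfun_trace F g : 'End(g) -> F^o).
Proof. by move=> a f h; rewrite !lfun_trace_mx linearP /= mxtraceD mxtraceZ. Qed.

HB.instance Definition _ := GRing.isLinear.Build F 'End(g) F^o _
  (@lfun_trace F g : 'End(g) -> F^o) lfun_trace_linear.

Lemma lfun_traceC f h : lfun_trace (f \o h)%VF = lfun_trace (h \o f)%VF.
Proof. by rewrite !lfun_trace_mx !(mxof_comp _ _ bP) mxtrace_mulC. Qed.

Lemma killingC x y : killing x y = killing y x.
Proof. exact: lfun_traceC. Qed.

Lemma killing_is_linear x : linear (killing x : g -> F^o).
Proof.
move=> a u v; rewrite /killing ad_linear comp_lfunDr -comp_lfunZr.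
exact: lfun_trace_linear.
Qed.

HB.instance Definition _ x :=
  GRing.isLinear.Build F g F^o _ (killing x : g -> F^o) (killing_is_linear x).

Lemma killingDr x u v : killing x (u + v) = killing x u + killing x v.
Proof. exact: (raddfD (killing x)). Qed.

Lemma killingZr x a v : killing x (a *: v) = a * killing x v.
Proof. exact: (linearZ_LR (killing x)). Qed.

Lemma killingNr x v : killing x (- v) = - killing x v.
Proof. exact: (raddfN (killing x)). Qed.

Lemma killing0r x : killing x 0 = 0.
Proof. exact: (raddf0 (killing x)). Qed.

Lemma killing_sumr I (r : seq I) (P : pred I) (E : I -> g) x :
  killing x (\sum_(i <- r | P i) E i) = \sum_(i <- r | P i) killing x (E i).
Proof. exact: (raddf_sum (killing x)). Qed.

Lemma killingDl x u v : killing (u + v) x = killing u x + killing v x.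
Proof. by rewrite ![killing _ x]killingC killingDr. Qed.

Lemma killingZl x a v : killing (a *: v) x = a * killing v x.
Proof. by rewrite ![killing _ x]killingC killingZr. Qed.

Lemma killingNl x v : killing (- v) x = - killing v x.
Proof. by rewrite ![killing _ x]killingC killingNr. Qed.

Lemma killing0l x : killing 0 x = 0.
Proof. by rewrite killingC killing0r. Qed.

Lemma killing_suml I (r : seq I) (P : pred I) (E : I -> g) x :
  killing (\sum_(i <- r | P i) E i) x = \sum_(i <- r | P i) killing (E i) x.
Proof. by rewrite killingC killing_sumr; apply: eq_bigr => i _; rewrite killingC. Qed.

(** The cyclicity of the trace, in the form that also serves derivations. *)
Lemma lfun_trace_comm f h k :
  lfun_trace (((f \o h) - (h \o f)) \o k)%VF =
  lfun_trace (f \o ((h \o k) - (k \o h)))%VF.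
Proof.
rewrite comp_lfunDl comp_lfunDr !comp_lfunNl !comp_lfunNr !raddfB /=.
by rewrite !comp_lfunA [lfun_trace ((f \o k) \o h)%VF]lfun_traceC comp_lfunA.
Qed.

Lemma killing_lie x y z : killing (lie x y) z = killing x (lie y z).
Proof. by rewrite /killing !ad_lie lfun_trace_comm. Qed.

Lemma killing_orthP U v :
  reflect (forall u, u \in U -> killing u v = 0) (v \in killing_orth U).
Proof.
apply: (iffP idP) => [vU u uU | vU].
  rewrite (coord_vbasis uU) killing_suml big1 // => i _; rewrite killingZl.
  have /subv_bigcapP/(_ i isT) := vU.
  by rewrite -memvE memv_ker lfunE => /eqP /= ->; rewrite mulr0.
rewrite memvE; apply/subv_bigcapP => i _.
rewrite -memvE memv_ker lfunE /= vU // vbasis_mem // mem_nth //.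
by rewrite size_tuple.
Qed.

End LieBasics.

(** * Engel's theorem *)

Section Engel.
Context {F : fieldType} {g : lieAlgType F}.
Implicit Types (L M U W : {vspace g}) (u v w x y z : g).

(** Says that [M] acts on every non-zero subquotient [U / W] with
    [[M, U / W]] smaller than [U / W].  This dual form of Engel's conclusion speaks
    of pairs of subspaces only, so that no quotient representation is needed. *)
Definition lie_shrinking M := forall U W,
  (lie_prod M U <= U)%VS -> (lie_prod M W <= W)%VS -> (W <= U)%VS ->
  (U <= lie_prod M U + W)%VS -> (U <= W)%VS.

Lemma lie_shrinking0 : lie_shrinking 0%VS.
Proof.
move=> U W _ _ _ /subv_trans; apply; rewrite subv_add subvv andbT.
by apply/lie_prodP => u v; rewrite memv0 => /eqP -> _; rewrite lie0l mem0v.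
Qed.

(** [M] acts on [L / M]; the last non-zero term of the descending chain obtained
    by iterating the action consists of vectors that normalize [M]. *)
Lemma lie_shrinking_normalizer M L : lie_shrinking M ->
  (lie_prod M M <= M)%VS -> (lie_prod M L <= L)%VS -> (M <= L)%VS ->
  ~~ (L <= M)%VS ->
  exists x, [/\ x \in L, x \notin M & forall m, m \in M -> lie m x \in M].
Proof.
move=> shM MM; have [n] := ubnP (\dim L); elim: n L => // n IHn L ltLn ML sML LM.
pose U := (lie_prod M L + M)%VS.
have sUL : (U <= L)%VS by rewrite subv_add ML.
have [sUM | nUM] := boolP (U <= M)%VS.
  have /subvPn[x xL xM] := LM; exists x; split=> // m mM.
  by apply: (subvP sUM); apply: (subvP (addvSl _ _)); apply: memv_lie_prod.
have ltUL : (\dim U < \dim L)%N.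
  rewrite ltn_neqAle dimvS // andbT; apply: contra LM => dimUL.
  by apply: shM => //; move: dimUL; rewrite (dimv_leqif_sup sUL).
have MU : (lie_prod M U <= U)%VS.
  by rewrite (subv_trans (lie_prodS (subvv M) sUL)) ?addvSl.
have [x [xU xM Mx]] := IHn U (leq_trans ltUL ltLn) MU (addvSr _ _) nUM.
by exists x; split=> //; apply: (subvP sUL).
Qed.

(** [[M, U] + W] is a proper subspace stable under [x]; since [x] acts nilpotently
    on the quotient of [U] by it, [x] cannot map that quotient onto itself. *)
Lemma lie_shrinking_add M x : lie_shrinking M ->
  (lie_prod M M <= M)%VS -> (forall m, m \in M -> lie m x \in M) ->
  ad_nilpotent x -> lie_shrinking (M + <[x]>)%VS.
Proof.
move=> shM MM Mx [k xk0] U W stU stW sWU sU.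
have sM : (M <= M + <[x]>)%VS := addvSl _ _.
have xM : x \in (M + <[x]>)%VS by apply: (subvP (addvSr _ _)); exact: memv_line.
have /lie_prodP stUM := subv_trans (lie_prodS sM (subvv U)) stU.
have stWM := subv_trans (lie_prodS sM (subvv W)) stW.
apply: shM => //; first exact/lie_prodP.
pose W' := (lie_prod M U + W)%VS.
have xU u : u \in U -> lie x u \in U by move=> uU; move/lie_prodP: stU; apply.
have xW' w : w \in W' -> lie x w \in W'.
  move=> /memv_addP[p pMU [q qW ->]]; rewrite lieDr; apply: memv_add; last by move/lie_prodP: stW; apply.
  have : (lie_prod M U <= ad x @^-1: lie_prod M U)%VS.
    apply/lie_prodP => m u mM uU; rewrite -memv_preim adE lie_deriv.
    apply: memvD; apply: memv_lie_prod => //; last exact: xU.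
    by rewrite lieC memvN Mx.
  by move/subvP/(_ p pMU); rewrite -memv_preim adE.
have xdiv u : u \in U -> exists2 u', u' \in U & u - lie x u' \in W'.
  move=> /(subvP sU) /memv_addP[p pU [q qW ->]].
  have /subvP/(_ p pU)/memv_addP[_ /memv_imgP[u' u'U ->] [r rMU ->]] :
      (lie_prod (M + <[x]>) U <= ad x @: U + lie_prod M U)%VS.
    apply/lie_prodP => _ v /memv_addP[m mM [_ /vlineP[a ->] ->]] vU.
    rewrite lieDl addrC memv_add ?memv_lie_prod // lieZl memvZ //.
    by rewrite -adE memv_img.
  exists u' => //; rewrite adE addrC -addrA addKr.
  exact: memv_add.
have xkdiv j u : u \in U -> exists2 u', u' \in U & u - iter j (lie x) u' \in W'.
  elim: j u => [|j IHj] u uU; first by exists u; rewrite ?subrr ?mem0v.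
  have [u1 u1U u1W] := xdiv u uU; have [u2 u2U u2W] := IHj u1 u1U.
  exists u2 => //=; rewrite -(subrK (lie x u1) u) -addrA -lieBr.
  by apply: memvD => //; apply: xW'.
apply/subvP => u uU; have [u' _] := xkdiv k u uU.
by rewrite xk0 subr0.
Qed.

(** Engel's theorem: starting from the zero subalgebra, adjoin one normalizing
    element at a time until the whole of [L] is reached. *)
Lemma ad_nilpotent_shrinking L : (lie_prod L L <= L)%VS ->
  {in L, forall x, ad_nilpotent x} -> lie_shrinking L.
Proof.
move=> LL nilL.
suff step n M : (\dim L - \dim M < n)%N -> (M <= L)%VS -> (lie_prod M M <= M)%VS ->
    lie_shrinking M -> lie_shrinking L.
  apply: (step (\dim L).+1 0%VS) => //; rewrite ?sub0v ?ltnS ?leq_subr //.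
  - by apply/lie_prodP => u v; rewrite memv0 => /eqP -> _; rewrite lie0l mem0v.
  - exact: lie_shrinking0.
elim: n M => // n IHn M ltn sML MM shM.
have [sLM | nLM] := boolP (L <= M)%VS.
  by rewrite (_ : L = M) //; apply: subv_anti; rewrite sLM.
have ML := subv_trans (lie_prodS sML (subvv L)) LL.
have [x [xL xM Mx]] := lie_shrinking_normalizer shM MM ML sML nLM.
have sM'L : (M + <[x]> <= L)%VS by rewrite subv_add sML -memvE.
apply: (IHn (M + <[x]>)%VS) => //.
- have ltM : (\dim M < \dim (M + <[x]>))%N.
    rewrite ltn_neqAle dimvS ?addvSl // andbT (dimv_leqif_sup (addvSl _ _)).
    by rewrite subv_add subvv -memvE.
  apply: (leq_trans _ (ltn : (_ <= n)%N)); rewrite ltn_sub2l // (leq_trans ltM) ?dimvS //.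
- apply/lie_prodP => _ _ /memv_addP[m mM [_ /vlineP[a ->] ->]]
    /memv_addP[m' m'M [_ /vlineP[a' ->] ->]].
  apply: (subvP (addvSl _ _)).
  rewrite lieDl !lieDr !lieZl !lieZr liexx !scaler0 addr0.
  apply: memvD; last by rewrite lieC scalerN memvN memvZ ?Mx.
  by apply: memvD; [exact: (subvP MM) (memv_lie_prod mM m'M) | rewrite memvZ ?Mx].
- exact: lie_shrinking_add (nilL x xL).
Qed.

(** A non-zero perfect subalgebra of ad-nilpotent elements would not shrink itself,
    so the derived series decreases strictly until it reaches zero. *)
Lemma ad_nilpotent_solvable L : (lie_prod L L <= L)%VS ->
  {in lie_prod L L, forall x, ad_nilpotent x} -> lie_solvable L.
Proof.
suff solv n U : (\dim U < n)%N -> (lie_prod U U <= U)%VS ->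
    {in U, forall x, ad_nilpotent x} -> lie_solvable U.
  move=> LL nilL; have [k Lk0] := solv _ _ (ltnSn _) (lie_prodS LL LL) nilL.
  by exists k.+1; rewrite iterSr.
elim: n U => // n IHn U ltn UU nilU.
have [sU | nU] := boolP (U <= lie_prod U U)%VS.
  exists 0%N; apply/eqP; rewrite /= -subv0.
  apply: (ad_nilpotent_shrinking UU nilU) => //; rewrite ?sub0v ?addv0 //.
  by apply/lie_prodP => u v _; rewrite memv0 => /eqP ->; rewrite lie0r mem0v.
have ltU : (\dim (lie_prod U U) < \dim U)%N.
  by rewrite ltn_neqAle dimvS // andbT (dimv_leqif_sup UU).
have [||k Uk0] := IHn (lie_prod U U) (leq_trans ltU ltn).
- exact: lie_prodS.
- by move=> x /(subvP UU); apply: nilU.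
by exists k.+1; rewrite iterSr.
Qed.

End Engel.

(** * Generalized eigenspaces *)

Lemma sub_kermxpoly_XsubC (F : fieldType) n (A : 'M[F]_n) (c : F) N (u : 'rV_n) :
  (u <= kermxpoly A (('X - c%:P) ^+ N))%MS =
  (iter N (fun w => w *m A - c *: w) u == 0).
Proof.
case: n A u => [|n] A u; first by rewrite !thinmx0 sub0mx eqxx.
rewrite (sameP sub_kermxP eqP); congr (_ == 0).
elim: N u => [|N IHN] u; first by rewrite expr0 rmorph1 mulmx1.
rewrite iterSr -IHN exprS rmorphM rmorphB /= horner_mx_X horner_mx_C -mulmxE.
by rewrite mulmxA mulmxBr mul_mx_scalar.
Qed.

Lemma kermxpoly_full (F : fieldType) n (A : 'M[F]_n) (p : {poly F}) :
  char_poly A %| p -> (kermxpoly A p :=: 1%:M)%MS.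
Proof.
case: n A => [|n] A Ap; first by rewrite [kermxpoly _ _]thinmx0 [1%:M]thinmx0.
exact/kermxpoly_min/(dvdp_trans (mxminpoly_dvd_char A)).
Qed.

Section GeneralizedEigenspaces.
Context {C : numClosedFieldType} {V : vectType C}.
Implicit Types (f : 'End(V)) (c : C) (v : V) (N : nat).

Let b := vbasis {:V}.
Let bP : basis_of {:V} b := vbasisP _.
Let bF : free b := basis_free bP.

Definition geigen f c N : {vspace V} :=
  vsof b (kermxpoly (mxof b b f) (('X - c%:P) ^+ N)).

Lemma mem_geigen f c N v :
  (v \in geigen f c N) = (iter N (fun u => f u - c *: u) v == 0).
Proof.
rewrite /geigen -rVof_sub // sub_kermxpoly_XsubC -(rVof_eq0 bP).
congr (_ == 0); elim: N v => [|N IHN] v //.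
by rewrite !iterSr -IHN -rVof_app // [in RHS]linearB [in RHS]linearZ.
Qed.

Lemma geigenS f c N M : (N <= M)%N -> (geigen f c N <= geigen f c M)%VS.
Proof.
move=> /subnK <-; apply/subvP => v; rewrite !mem_geigen iterD => /eqP ->.
by elim: (M - N)%N => [|n IHn] //; rewrite iterS (eqP IHn) linear0 scaler0 subr0.
Qed.

Lemma geigen_stable f c N v : v \in geigen f c N -> f v \in geigen f c N.
Proof.
rewrite !mem_geigen => /eqP vN.
suff -> : iter N (fun u => f u - c *: u) (f v) = f (iter N (fun u => f u - c *: u) v).
  by rewrite vN linear0.
by elim: N {vN} => [|N IHN] //; rewrite !iterS IHN [RHS]linearB [in RHS]linearZ.
Qed.

(** Over an algebraically closed field the space is the direct sum of the
    generalized eigenspaces, by the Cayley-Hamilton theorem. *)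
Lemma geigen_decomposition f : exists rs : seq C,
  [/\ uniq rs, forall c, c \in rs <-> exists2 v, v != 0 & f v = c *: v &
      forall N, (\dim {:V} <= N)%N ->
        (\sum_(i < size rs) geigen f rs`_i N)%VS = fullv /\
        directv (\sum_(i < size rs) geigen f rs`_i N)].
Proof.
pose A := mxof b b f.
have [r] := closed_field_poly_normal (char_poly A).
rewrite (monicP (char_poly_monic A)) scale1r => Ar.
have szr : size r = \dim {:V}.
  by have := size_char_poly A; rewrite Ar size_prod_XsubC => -[].
exists (undup r); split; first exact: undup_uniq.
  move=> c; rewrite mem_undup -root_prod_XsubC -Ar -eigenvalue_root_char.
  split=> [/eigenvalueP[u uA u0] | [v v0 fv]].
    exists (vecof b u); first by rewrite vecof_eq0.
    by rewrite (hom_vecof b bP) uA linearZ.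
  apply/eigenvalueP; exists (rVof b v); last by rewrite rVof_eq0.
  by rewrite -rVof_app // fv linearZ.
move=> N leN; set m := size _.
pose p_ (i : 'I_m) : {poly C} := ('X - ((undup r)`_i)%:P) ^+ N.
have cop : {in predT &, forall i j, j != i -> coprimep (p_ i) (p_ j)}.
  move=> i j _ _ Nij; rewrite /p_ coprimep_expr // coprimep_expl //.
  rewrite coprimep_XsubC root_XsubC nth_uniq ?undup_uniq //.
have full := kermxpoly_prod A cop.
have dir := mxdirect_sum_kermx A cop.
have Ap : char_poly A %| \prod_(i < m) p_ i.
  rewrite Ar -prodr_undup_exp_count (big_nth 0) big_mkord.
  apply: (big_ind2 (fun p q : {poly C} => p %| q)) => [|p q p' q'|i _] //.
    exact: dvdp_mul.
  by rewrite dvdp_exp2l // (leq_trans (count_size _ _)) ?szr.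
split.
  apply/vspaceP => v; rewrite memvf.
  have /sub_sumsmxP[u vE] : (rVof b v <= \sum_i kermxpoly A (p_ i))%MS.
    by rewrite -full kermxpoly_full ?submx1.
  rewrite -(rVofK bP v) vE linear_sum memv_sumr // => i _.
  by rewrite /geigen -rVof_sub // vecofK // submxMl.
apply/directv_sumP => i _; apply/eqP; rewrite -subv0; apply/subvP => v.
rewrite memv_cap memv0 => /andP[vi /memv_sumP[vs vsE vE]].
rewrite -(rVof_eq0 bP) -submx0 -(mxdirect_sumsP dir i isT) sub_capmx.
apply/andP; split; first by rewrite rVof_sub.
rewrite vE linear_sum summx_sub // => j ji; apply: (sumsmx_sup j) => //.
by rewrite rVof_sub // vsE.
Qed.

End GeneralizedEigenspaces.

(** Brackets add generalized eigenvalues of [ad x]: the operator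
    [ad x - (a + c)] acts on [[u, v]] by the Leibniz rule through [ad x - a] on [u]
    and [ad x - c] on [v]. *)
Lemma lie_deriv_iter (F : fieldType) (g : lieAlgType F) (x : g) (a c : F) p q u v :
  iter p (fun w => lie x w - a *: w) u = 0 ->
  iter q (fun w => lie x w - c *: w) v = 0 ->
  iter (p + q) (fun w => lie x w - (a + c) *: w) (lie u v) = 0.
Proof.
have iter0 n : iter n (fun w => lie x w - (a + c) *: w) 0 = 0.
  by elim: n => //= n ->; rewrite lie0r scaler0 subr0.
have [n] := ubnP (p + q); elim: n p q u v => // n IHn [|p] [|q] u v.
- by move=> _ u0 _; rewrite (u0 : u = 0) lie0l.
- by move=> _ u0 _; rewrite (u0 : u = 0) lie0l iter0.
- by move=> _ _ v0; rewrite (v0 : v = 0) lie0r iter0.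
move=> lt_n up vq; rewrite addSn iterSr.
pose u' := lie x u - a *: u; pose v' := lie x v - c *: v.
have -> : lie x (lie u v) - (a + c) *: lie u v = lie u' v + lie u v'.
  rewrite lie_deriv lieBl lieBr lieZl lieZr scalerDl opprD.
  by rewrite addrACA.
have iterDD k w1 w2 : iter k (fun w => lie x w - (a + c) *: w) (w1 + w2) =
    iter k (fun w => lie x w - (a + c) *: w) w1 +
    iter k (fun w => lie x w - (a + c) *: w) w2.
  by elim: k => //= k ->; rewrite lieDr scalerDr opprD addrACA.
rewrite iterDD (IHn p q.+1) //; last by rewrite -iterSr.
  by rewrite addnS -addSn (IHn p.+1 q) ?addr0 // -?iterSr // addSn -addnS.
Qed.

(** * Cartan's criterion *)

Section Cartan.
Context {C : numClosedFieldType} {g : lieAlgType C}.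
Implicit Types (x y u v w : g) (h D : 'End(g)) (a c : C) (U : {vspace g}).

(** The trace is the sum of the roots of the characteristic polynomial. *)
Lemma trace0_eigenvalues_ge0 h :
  (forall a v, v != 0 -> h v = a *: v -> 0 <= a) -> lfun_trace h = 0 ->
  forall a v, v != 0 -> h v = a *: v -> a = 0.
Proof.
set b := vbasis {:g}; have bP : basis_of {:g} b := vbasisP _.
move=> h_ge0 tr0 a v v0 hv; pose A := mxof b b h.
have [r] := closed_field_poly_normal (char_poly A).
rewrite (monicP (char_poly_monic A)) scale1r => Ar.
have szr : size r = \dim {:g}.
  by have := size_char_poly A; rewrite Ar size_prod_XsubC => -[].
have r_eig c : c \in r <-> eigenvalue A c.
  by rewrite eigenvalue_root_char Ar root_prod_XsubC.
have r_ge0 c : c \in r -> 0 <= c.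
  move=> /r_eig /eigenvalueP[u uA u0].
  apply: (h_ge0 c (vecof b u)); first by rewrite vecof_eq0.
  by rewrite (hom_vecof b bP) // uA linearZ.
have a_r : a \in r.
  apply/r_eig/eigenvalueP; exists (rVof b v); last by rewrite rVof_eq0.
  by rewrite -rVof_app // hv linearZ.
have r0 : size r != 0%N by case: (r) a_r.
have : \sum_(c <- r) c == 0.
  rewrite -oppr_eq0 -coefPn_prod_XsubC // -Ar szr.
  by rewrite char_poly_trace -?szr ?lt0n // -lfun_trace_mx tr0 oppr0.
rewrite big_seq psumr_eq0 // => /allP/(_ a a_r)/implyP/(_ a_r).
by move/eqP.
Qed.

(** Letting the derivation act on each generalized eigenspace of [ad x] by the
    conjugate of the eigenvalue is compatible with brackets because conjugation
    is additive and brackets add eigenvalues. *)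
Lemma conj_derivation x : exists D : 'End(g),
  [/\ lie_derivation D,
      forall a v, lie x v = a *: v -> D v = a^* *: v &
      forall a v, v != 0 -> (ad x \o D)%VF v = a *: v -> 0 <= a].
Proof.
have [rs [rs_uniq rsP rs_dec]] := geigen_decomposition (ad x).
set n := \dim {:g} in rs_dec; set m := size rs in rs_dec.
have [full dir] := rs_dec (n + n)%N (leq_addr _ _).
(* The doubled exponent leaves room for the bracket of two vectors that are
   killed by n-th powers. *)
pose E (i : 'I_m) := geigen (ad x) rs`_i (n + n).
have sumE : (\sum_(i < m) E i)%VS = fullv by [].
pose D := \sum_(i < m) (rs`_i)^* *: sumv_pi_for (esym sumE) i.
have DE i v : v \in E i -> D v = (rs`_i)^* *: v.
  move=> vi.
  have vsum : v = \sum_j (if j == i then v else 0).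
    by rewrite -big_mkcond big_pred1_eq.
  have /directv_sum_unique/(_ (fun j => sumv_pi_for (esym sumE) j v)
      (fun j => if j == i then v else 0)) := dir.
  rewrite -vsum sumv_pi_sum ?memvf // eqxx => /(_ _ _)/esym/forall_inP piE.
  rewrite /D sum_lfunE [RHS](_ : _ = (rs`_i)^* *: \sum_j (if j == i then v else 0)).
    rewrite scaler_sumr; apply: eq_bigr => j _; rewrite scale_lfunE.
    rewrite (eqP (piE _ _ j isT)) => [|k _|k _]; last 2 first.
    - exact: memv_sum_pi.
    - by case: eqP => [->|_]; rewrite ?mem0v.
    by case: eqP => [->|_] //; rewrite !scaler0.
  by rewrite -vsum.
have eig0 c N w : c \notin rs -> w \in geigen (ad x) c N -> w = 0.
  move=> c_rs; elim: N w => [|N IHN] w; rewrite mem_geigen; first by move/eqP.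
  rewrite iterSr -mem_geigen => /IHN /eqP; rewrite subr_eq0 => /eqP xw.
  by apply/eqP; apply: contraNT c_rs => w0; apply/rsP; exists w.
have dec N v : (n <= N)%N -> exists2 vs : 'I_m -> g,
    forall i, vs i \in geigen (ad x) rs`_i N & v = \sum_i vs i.
  move=> /rs_dec [fullN _].
  have /memv_sumP[vs vsE ->] : v \in (\sum_(i < m) geigen (ad x) rs`_i N)%VS.
    by rewrite fullN memvf.
  by exists vs => // i; exact: vsE.
exists D; split.
- move=> u v; have [us usE ->] := dec n u (leqnn n).
  have [vs vsE ->] := dec n v (leqnn n).
  set v' := \sum_i vs i; rewrite (linear_sum D) !lie_suml (linear_sum D).
  rewrite -big_split /=; apply: eq_bigr => i _; rewrite {}/v'.
  rewrite (linear_sum D) !lie_sumr (linear_sum D) -big_split /=.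
  apply: eq_bigr => j _.
  have subE (k : 'I_m) w : w \in geigen (ad x) rs`_k n -> w \in E k.
    exact/subvP/geigenS/leq_addr.
  rewrite (DE _ _ (subE _ _ (usE i))) (DE _ _ (subE _ _ (vsE j))).
  rewrite lieZl lieZr -scalerDl -rmorphD.
  have uvE : lie (us i) (vs j) \in geigen (ad x) (rs`_i + rs`_j) (n + n).
    rewrite mem_geigen; apply/eqP.
    under eq_iter do rewrite adE.
    apply: lie_deriv_iter.
    + by have := usE i; rewrite mem_geigen => /eqP; under eq_iter do rewrite adE.
    + by have := vsE j; rewrite mem_geigen => /eqP; under eq_iter do rewrite adE.
  have [ij_rs | ij_rs] := boolP (rs`_i + rs`_j \in rs); last first.
    by rewrite (eig0 _ _ _ ij_rs uvE) linear0 scaler0.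
  move: uvE; rewrite -{1 2}(nth_index 0 ij_rs).
  have lt_ij : (index (rs`_i + rs`_j)%R rs < m)%N by rewrite index_mem.
  by move=> /(DE (Ordinal lt_ij)) ->; rewrite /= nth_index.
- move=> a v xv; have [-> | v0] := eqVneq v 0; first by rewrite linear0 scaler0.
  have a_rs : a \in rs by apply/rsP; exists v; rewrite ?adE.
  have lt_a : (index a rs < m)%N by rewrite index_mem.
  have := DE (Ordinal lt_a) v; rewrite /E /= nth_index // => -> //.
  rewrite mem_geigen; have nn0 : (0 < n + n)%N.
    by rewrite addn_gt0 orbb /n lt0n dimv_eq0; apply: contraNneq v0 => g0;
       rewrite -memv0 -g0 memvf.
  case: (n + n)%N nn0 => // N _; rewrite iterSr adE xv subrr.
  by rewrite -mem_geigen mem0v.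
move=> a v v0; rewrite comp_lfunE => xDv.
have [vs vsE vE] := dec (n + n)%N v (leq_addr _ _).
have xDE i w : w \in E i -> (ad x) (D w) \in E i.
  by move=> wi; rewrite (DE i) // linearZ memvZ // geigen_stable.
have xDvs i : ad x (D (vs i)) = a *: vs i.
  have /directv_sum_unique/(_ (fun j => ad x (D (vs j))) (fun j => a *: vs j)) := dir.
  rewrite -scaler_sumr -vE -xDv vE (linear_sum D) (linear_sum (ad x)).
  rewrite eqxx.
  move=> /(_ _ _)/esym/forall_inP xDvsE; apply/eqP.
  by apply: xDvsE => // j _; [exact: xDE | rewrite memvZ].
have [i vi0] : exists i, vs i != 0.
  apply/existsP; apply: contraNT v0 => /existsPn vs0; rewrite vE big1 // => i _.
  by apply/eqP/negPn/vs0.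
have := xDvs i; rewrite (DE i) // linearZ /= adE => xvi.
suff -> : a = rs`_i * (rs`_i)^* by rewrite mul_conjC_ge0.
have [r0 | r0] := eqVneq (rs`_i) 0.
  rewrite r0 mul0r; apply/eqP; move: xvi; rewrite r0 rmorph0 scale0r => /esym/eqP.
  by rewrite scaler_eq0 (negPf vi0) orbF.
have rc0 : (rs`_i)^* != 0 by rewrite conjC_eq0.
have vi_eig : ad x (vs i) = ((rs`_i)^*^-1 * a) *: vs i.
  by rewrite adE -scalerA -xvi scalerA mulVf // scale1r.
have := vsE i; rewrite mem_geigen.
have -> : iter (n + n) (fun u => ad x u - rs`_i *: u) (vs i) =
    (((rs`_i)^*^-1 * a) - rs`_i) ^+ (n + n) *: vs i.
  elim: (n + n)%N => [|N /= ->]; first by rewrite scale1r.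
  rewrite linearZ /= vi_eig !scalerA exprSr -scalerBl; congr (_ *: _).
  by rewrite mulrBr [rs`_i * _]mulrC.
rewrite scaler_eq0 (negPf vi0) orbF expf_eq0 => /andP[_].
rewrite subr_eq0 => /eqP /(congr1 ( *%R (rs`_i)^*)).
by rewrite mulVKf // mulrC.
Qed.

(** Pairing [ad x] with the conjugate derivation computes the sum of the squared
    moduli of the eigenvalues of [ad x]; for [x] a bracket with an element of the
    radical this sum is a value of the Killing form on the radical, hence zero. *)
Lemma ad_nilpotent_killing_radical U x :
  x \in lie_prod (killing_orth {:g}) U -> ad_nilpotent x.
Proof.
move=> xU; have [D [DD Deig Dpos]] := conj_derivation x.
have tr_linear : linear (fun y => lfun_trace (ad y \o D)%VF : C^o).
  move=> a u v; rewrite ad_linear comp_lfunDl -comp_lfunZl.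
  exact: lfun_trace_linear.
pose phi : {linear g -> C^o} := HB.pack (fun y => lfun_trace (ad y \o D)%VF : C^o)
  (GRing.isLinear.Build C g C^o _ _ tr_linear).
have tr0 : lfun_trace (ad x \o D)%VF = 0.
  have sU : (lie_prod (killing_orth {:g}) U <= lker (linfun phi))%VS.
    apply/lie_prodP => u v /killing_orthP u0 _; rewrite memv_ker lfunE /=.
    rewrite ad_lie lfun_trace_comm -opprB -ad_derivation // comp_lfunNr raddfN /=.
    by rewrite oppr_eq0 lfun_traceC; apply/eqP/u0/memvf.
  by move/subvP: sU => /(_ x xU); rewrite memv_ker lfunE => /eqP.
have eig0 a v : v != 0 -> lie x v = a *: v -> a = 0.
  move=> v0 xv; apply/eqP; rewrite -mul_conjC_eq0; apply/eqP.
  apply: (trace0_eigenvalues_ge0 Dpos tr0 v0).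
  by rewrite comp_lfunE (Deig _ _ xv) linearZ /= adE xv scalerA mulrC.
have [rs [_ rsP /(_ _ (leqnn _))[full _]]] := geigen_decomposition (ad x).
exists (\dim {:g}) => y.
have : y \in geigen (ad x) 0 (\dim {:g}).
  have : y \in (\sum_(i < size rs) geigen (ad x) rs`_i (\dim {:g}))%VS.
    by rewrite full memvf.
  move=> /memv_sumP[vs vsE ->]; apply: memv_suml => i _.
  have /rsP[v v0] : rs`_i \in rs by rewrite mem_nth.
  rewrite adE => /eig0 - /(_ v0) ri0.
  by rewrite -[X in geigen _ X _]ri0; exact: vsE.
rewrite mem_geigen => /eqP; under eq_iter do rewrite scale0r subr0 adE.
by [].
Qed.

(** Cartan's criterion: the radical of the Killing form is an ideal whose derived
    algebra consists of ad-nilpotent elements, hence a solvable ideal. *)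
Theorem killing_nondegenerate : semisimple g ->
  forall x, (forall y, killing x y = 0) -> x = 0.
Proof.
move=> ss x x0.
have ideal y u : u \in killing_orth {:g} -> lie y u \in killing_orth {:g}.
  move=> /killing_orthP u0; apply/killing_orthP => z _.
  by rewrite -killing_lie u0 // memvf.
have : x \in killing_orth {:g} by apply/killing_orthP => u _; rewrite killingC.
rewrite (ss (killing_orth {:g})) ?memv0 => [/eqP|//|].
  by [].
apply: ad_nilpotent_solvable; first by apply/lie_prodP => u v _; exact: ideal.
by move=> y; exact: ad_nilpotent_killing_radical.
Qed.

End Cartan.

(** * Forms non-degenerate on a subspace *)

Section Forms.
Context {F : fieldType} {V : vectType F}.
Variable B : V -> V -> F.
Hypothesis Bl : forall v, linear (fun u => B u v : F^o).
Hypothesis Br : forall u, linear (fun v => B u v : F^o).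

Definition nondegenerate_on (U : {vspace V}) :=
  forall u, u \in U -> (forall v, v \in U -> B u v = 0) -> u = 0.

Definition gram_mx d (X : d.-tuple V) : 'M[F]_d :=
  \matrix_(i, j) B (tnth X i) (tnth X j).

Let form_suml (I : finType) (c : I -> F) (X : I -> V) v :
  B (\sum_i c i *: X i) v = \sum_i c i * B (X i) v.
Proof.
pose f : {linear V -> F^o} := HB.pack (fun u => B u v : F^o)
  (GRing.isLinear.Build F V F^o _ _ (Bl v)).
have := linear_sum f (index_enum I) xpredT (fun i => c i *: X i).
by move=> /= ->; apply: eq_bigr => i _; exact: (linearZ_LR f).
Qed.

Let form_sumr (I : finType) (c : I -> F) (X : I -> V) u :
  B u (\sum_i c i *: X i) = \sum_i c i * B u (X i).
Proof.
pose f : {linear V -> F^o} := HB.pack (fun v => B u v : F^o)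
  (GRing.isLinear.Build F V F^o _ _ (Br u)).
have := linear_sum f (index_enum I) xpredT (fun i => c i *: X i).
by move=> /= ->; apply: eq_bigr => i _; exact: (linearZ_LR f).
Qed.

Let basis_sum U d (X : d.-tuple V) v : basis_of U X -> v \in U ->
  exists c : 'I_d -> F, v = \sum_i c i *: tnth X i.
Proof.
move=> XU vU; exists (fun i => coord X i v); rewrite {1}(coord_basis XU vU).
by apply: eq_bigr => i _; rewrite (tnth_nth 0).
Qed.

Lemma form_basis0 U d (X : d.-tuple V) u : basis_of U X ->
  (forall j, B u (tnth X j) = 0) -> forall v, v \in U -> B u v = 0.
Proof.
move=> XU u0 v /(basis_sum XU)[c ->].
by rewrite form_sumr big1 // => j _; rewrite u0 mulr0.
Qed.

Lemma gram_mx_unit U d (X : d.-tuple V) :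
  basis_of U X -> nondegenerate_on U -> gram_mx X \in unitmx.
Proof.
move=> XU ndU; rewrite -row_free_unit -kermx_eq0; apply/rowV0P => a /sub_kermxP aX.
have a0 : \sum_i a 0 i *: tnth X i = 0.
  apply: ndU.
    apply: memv_suml => i _; rewrite memvZ // (basis_mem XU) //.
    exact: mem_tnth.
  apply: (form_basis0 XU) => j; rewrite form_suml.
  have /rowP/(_ j) := aX; rewrite !mxE => aXj; apply: etrans aXj.
  by apply: eq_bigr => i _; rewrite mxE.
apply/rowP => i; rewrite mxE; have /freeP/(_ (fun i => a 0 i)) := basis_free XU.
apply; apply: etrans a0; apply: eq_bigr => j _.
by rewrite (tnth_nth 0).
Qed.

Lemma form_dual U d (X : d.-tuple V) (c : 'I_d -> F) :
  basis_of U X -> nondegenerate_on U ->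
  exists2 z, z \in U & forall j, B z (tnth X j) = c j.
Proof.
move=> XU ndU; pose a := (\row_j c j) *m invmx (gram_mx X).
exists (\sum_i a 0 i *: tnth X i).
  apply: memv_suml => i _; rewrite memvZ // (basis_mem XU) //.
  exact: mem_tnth.
move=> j; rewrite form_suml.
have : (a *m gram_mx X) 0 j = c j by rewrite mulmxKV ?mxE // (gram_mx_unit XU).
by rewrite mxE => aj; apply: etrans aj; apply: eq_bigr => i _; rewrite [gram_mx _ _ _]mxE.
Qed.

End Forms.

(** * Consequences of the non-degeneracy of the Killing form *)

Section KillingForm.
Context {F : fieldType} {g : lieAlgType F}.
Implicit Types (M U : {vspace g}) (m x y u v w : g) (D : 'End(g)).

Lemma killing_linearl v : linear (fun u => killing u v : F^o).
Proof. by move=> a u w; rewrite killingDl killingZl. Qed.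

Lemma killing_linearr u : linear (fun v => killing u v : F^o).
Proof. exact: killing_is_linear. Qed.

Lemma killing_inj M u w : nondegenerate_on killing M -> u \in M -> w \in M ->
  (forall v, v \in M -> killing u v = killing w v) -> u = w.
Proof.
move=> ndM uM wM uw; apply/eqP; rewrite -subr_eq0; apply/eqP.
by apply: ndM => [|v vM]; rewrite ?memvB // killingDl killingNl uw ?subrr.
Qed.

(** Derivations are inner: subtract the inner derivation with the same trace
    pairing against [ad g]; invariance then makes the difference vanish. *)
Lemma derivation_inner D : nondegenerate_on (@killing F g) {:g} ->
  lie_derivation D -> exists y, D = ad y.
Proof.
move=> nd DD.
have [y _ yD] := form_dual killing_linearl killing_linearr
  (fun i => lfun_trace (D \o ad (tnth (vbasis {:g}) i))%VF) (vbasisP _) nd.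
exists y; pose E := D - ad y.
have DE : lie_derivation E.
  move=> u v; rewrite !(add_lfunE, opp_lfunE) DD !adE lie_deriv lieBl lieBr.
  by rewrite opprD addrACA.
have trE v : lfun_trace (E \o ad v)%VF = 0.
  rewrite (coord_vbasis (memvf v)).
  elim/big_rec: _ => [|i w _ IHw].
    rewrite (_ : ad 0 = 0) ?comp_lfun0r ?(raddf0 (@lfun_trace F g)) //.
    by apply/lfunP => z; rewrite adE lie0l zero_lfunE.
  rewrite ad_linear comp_lfunDr -comp_lfunZr lfun_trace_linear IHw addr0.
  rewrite comp_lfunDl comp_lfunNl (raddfB (@lfun_trace F g)) /=.
  have := yD i; rewrite (tnth_nth 0) => <-.
  by rewrite /killing subrr scaler0.
suff : E = 0 by move/eqP; rewrite subr_eq0 => /eqP.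
apply/lfunP => u; rewrite zero_lfunE; apply: nd; first exact: memvf.
by move=> v _; rewrite /killing ad_derivation // lfun_trace_comm -ad_lie trE.
Qed.

End KillingForm.

(** * Semisimple elements and Jordan decompositions *)

Section Jordan.
Context {F : fieldType} {g : lieAlgType F}.
Implicit Types (x y s e u v w : g).

Lemma ad_semisimple_decomposition s w : ad_semisimple s ->
  exists w0 w1, w0 \in centralizer s /\ w = w0 + lie s w1.
Proof.
move=> [b [bP sb]]; rewrite (coord_basis bP (memvf w)).
elim/big_rec: _ => [|i u _ [w0 [w1 [w0s ->]]]].
  by exists 0, 0; rewrite mem0v lie0r addr0.
have [a] := sb i; rewrite (tnth_nth 0); set c := coord _ _ _; set v := b`_i => sv.
have [a0 | a0] := eqVneq a 0.
  exists (c *: v + w0), w1; rewrite addrA; split=> //.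
  by rewrite memvD // memvZ // mem_centralizer sv a0 scale0r.
exists w0, (c *: (a^-1 *: v) + w1); split=> //.
by rewrite lieDr !lieZr sv [a^-1 *: _]scalerA mulVf // scale1r addrCA.
Qed.

Lemma ad_semisimple_iter_eq0 s k y : ad_semisimple s ->
  iter k (lie s) y = 0 -> lie s y = 0.
Proof.
move=> [b [bP sb]] sky0.
have bF := basis_free bP; have yE := coord_basis bP (memvf y).
have {}sb (i : 'I_(\dim {:g})) : lie s b`_i = coord b i (lie s b`_i) *: b`_i.
  have [a] := sb i; rewrite (tnth_nth 0) => sbi.
  by rewrite {1}sbi sbi linearZ /= coord_free // eqxx mulr1.
pose a (i : 'I_(\dim {:g})) := coord b i (lie s b`_i).
have skE j : iter j (lie s) y = \sum_i (coord b i y * a i ^+ j) *: b`_i.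
  elim: j => [|j /= ->].
    by rewrite {1}yE; apply: eq_bigr => i _; rewrite mulr1.
  rewrite lie_sumr; apply: eq_bigr => i _.
  by rewrite lieZr sb scalerA exprSr mulrA.
have /= -> := skE 1%N; apply: big1 => i _; rewrite expr1.
have /freeP/(_ (fun i => coord b i y * a i ^+ k)) := bF.
rewrite -skE => /(_ sky0 i)/eqP; rewrite mulf_eq0 expf_eq0.
by case/orP => [|/andP[_]] /eqP ->; rewrite ?mul0r ?mulr0 scale0r.
Qed.

(** On the centralizer of [x = s + e] the operators [ad s] and [- ad e] agree, so
    [ad s] is there both semisimple and nilpotent. *)
Lemma centralizer_jordan x s e : jordan_chevalley x s e ->
  centralizer x = (centralizer s :&: centralizer e)%VS.
Proof.
move=> [-> s_ss [k ek0] se0]; apply/vspaceP => y; rewrite memv_cap !mem_centralizer.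
apply/eqP/andP => [|[/eqP s0 /eqP e0]]; last by rewrite lieDl s0 e0 addr0.
move=> xy0; suff sy0 : lie s y = 0 by move: xy0; rewrite lieDl sy0 add0r => ->.
have xe0 j : lie (s + e) (iter j (lie e) y) = 0.
  elim: j => //= j IHj; rewrite lie_deriv IHj lie0r addr0.
  by rewrite lieDl se0 liexx addr0 lie0l.
apply: (@ad_semisimple_iter_eq0 s k) => //.
suff -> : iter k (lie s) y = (-1) ^+ k *: iter k (lie e) y.
  by rewrite ek0 scaler0.
elim: k {ek0} => [|k /= ->]; first by rewrite scale1r.
rewrite lieZr exprS mulN1r scaleNr -scalerN; congr (_ *: _).
by apply/eqP; rewrite -addr_eq0 -lieDl xe0.
Qed.

Lemma lie_prod_centralizer s :
  (lie_prod (centralizer s) (centralizer s) <= centralizer s)%VS.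
Proof.
apply/lie_prodP => u v; rewrite !mem_centralizer => /eqP su /eqP sv.
by rewrite lie_deriv su sv lie0l lie0r addr0.
Qed.

Lemma killing_centralizer_bracket s u w :
  u \in centralizer s -> killing u (lie s w) = 0.
Proof.
by rewrite mem_centralizer lieC oppr_eq0 -killing_lie => /eqP ->; rewrite killing0l.
Qed.

(** [g = g(s) + [s, g]], and the two summands are orthogonal by invariance. *)
Lemma killing_centralizer_nondegenerate s :
  nondegenerate_on (@killing F g) {:g} -> ad_semisimple s ->
  nondegenerate_on killing (centralizer s).
Proof.
move=> nd s_ss u us u0; apply: nd (memvf u) _ => w _.
have [w0 [w1 [w0s ->]]] := ad_semisimple_decomposition w s_ss.
by rewrite killingDr u0 // killing_centralizer_bracket // addr0.
Qed.

Lemma centralizer_orth s : ad_semisimple s ->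
  (centralizer s + killing_orth (centralizer s))%VS = fullv.
Proof.
move=> s_ss; apply/vspaceP => w; rewrite memvf.
have [w0 [w1 [w0s ->]]] := ad_semisimple_decomposition w s_ss.
apply: memv_add => //; apply/killing_orthP => u us.
exact: killing_centralizer_bracket.
Qed.

Lemma capv_killing_orth (M : {vspace g}) : nondegenerate_on killing M ->
  (M :&: killing_orth M = 0)%VS.
Proof.
move=> ndM; apply/eqP; rewrite -subv0; apply/subvP => v; rewrite memv_cap memv0.
by case/andP => vM /killing_orthP vO; apply/eqP/ndM => // u uM; rewrite killingC vO.
Qed.

Lemma killing_orth_add (U W : {vspace g}) :
  killing_orth (U + W)%VS = (killing_orth U :&: killing_orth W)%VS.
Proof.
apply/vspaceP => v; rewrite memv_cap; apply/killing_orthP/andP => [vUW | [vU vW]].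
  by split; apply/killing_orthP => u uU; apply: vUW;
     [apply: (subvP (addvSl _ _)) | apply: (subvP (addvSr _ _))].
move=> _ /memv_addP[u uU [w wW ->]].
by rewrite killingDl (killing_orthP _ _ vU) // (killing_orthP _ _ vW) // addr0.
Qed.

Lemma killing_orth_orth (M : {vspace g}) : nondegenerate_on (@killing F g) {:g} ->
  (M + killing_orth M)%VS = fullv -> killing_orth (killing_orth M) = M.
Proof.
move=> nd sumM; apply/vspaceP => v; apply/idP/idP => [vOO | vM]; last first.
  by apply/killing_orthP => u /killing_orthP uO; rewrite killingC uO.
have : v \in (M + killing_orth M)%VS by rewrite sumM memvf.
case/memv_addP => v0 v0M [v1 v1O vE].
suff v10 : v1 = 0 by rewrite vE v10 addr0.
apply: nd (memvf v1) _ => w _.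
have : w \in (M + killing_orth M)%VS by rewrite sumM memvf.
case/memv_addP => w0 w0M [w1 w1O ->]; rewrite killingDr.
rewrite [killing v1 w0]killingC (killing_orthP _ _ v1O) // add0r.
have -> : v1 = v - v0 by rewrite vE addrC addKr.
rewrite killingDl killingNl killingC (killing_orthP _ _ vOO) //.
by rewrite (killing_orthP _ _ w1O) ?subr0.
Qed.

End Jordan.

(** * Complements of the tangent space of an orbit *)

Section TransverseComplement.
Context {F : fieldType} {g : lieAlgType F}.
Variables (M N : {vspace g}) (m : g).
Hypothesis MM : (lie_prod M M <= M)%VS.
Hypothesis mM : m \in M.
Hypothesis ndM : nondegenerate_on killing M.
Hypothesis sumM : ((M :&: centralizer m) + N)%VS = M.
Hypothesis dirM : ((M :&: centralizer m) :&: N = 0)%VS.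

Let mlie v : v \in M -> lie m v \in M.
Proof. by move=> vM; exact: (subvP MM) (memv_lie_prod mM vM). Qed.

Let NM : (N <= M)%VS. Proof. by rewrite -sumM addvSr. Qed.

Let bracket_orth u v : v \in centralizer m -> killing (lie m u) v = 0.
Proof.
rewrite mem_centralizer => /eqP mv0.
by rewrite [lie m u]lieC killingNl killing_lie mv0 killing0r oppr0.
Qed.

(** The radical on [M] of the form [u, v |-> <m | [u, v]> = <[m, u] | v>] is the
    centralizer of [m], of which [N] is a complement. *)
Lemma bracket_form_nondegenerate :
  nondegenerate_on (fun u v => killing m (lie u v)) N.
Proof.
move=> u uN u0; have uM := subvP NM _ uN.
have mu0 : lie m u = 0.
  apply: ndM => [|v]; first exact: mlie.
  rewrite -{1}sumM => /memv_addP[v0 /memv_capP[_ v0m] [v1 v1N ->]].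
  by rewrite killingDr bracket_orth // killing_lie u0 // addr0.
apply/eqP; rewrite -memv0 -dirM !memv_cap uM uN mem_centralizer mu0 eqxx //.
Qed.

Lemma bracket_form_linearl (y v : g) :
  linear (fun u => killing y (lie u v) : F^o).
Proof. by move=> a u w; rewrite lieDl lieZl killingDr killingZr. Qed.

Lemma bracket_form_linearr (y u : g) :
  linear (fun v => killing y (lie u v) : F^o).
Proof. by move=> a v w; rewrite lieDr lieZr killingDr killingZr. Qed.

Lemma bracket_mx_unit d (X : d.-tuple g) : basis_of N X ->
  bracket_mx X X m \in unitmx.
Proof.
move=> XN; apply: (gram_mx_unit (bracket_form_linearl m) (bracket_form_linearr m) XN).
exact: bracket_form_nondegenerate.
Qed.

(** Duality on [N] provides, for each [w], some [z] in [N] such that [[m, z]] and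
    [w] have the same products with [N]; then [w - [m, z]] is orthogonal to [N]. *)
Lemma tangent_complement_sum :
  ((ad m @: M) + (M :&: killing_orth N))%VS = M.
Proof.
apply/eqP; rewrite eqEsubv subv_add capvSl andbT; apply/andP; split.
  by apply/subvP => _ /memv_imgP[v vM ->]; rewrite adE mlie.
apply/subvP => w wM.
have [z zN zE] := form_dual (bracket_form_linearl m) (bracket_form_linearr m)
  (fun i => killing w (tnth (vbasis N) i)) (vbasisP N) bracket_form_nondegenerate.
have zM := subvP NM _ zN.
rewrite -(subrK (lie m z) w) addrC memv_add //; first by rewrite -adE memv_img.
rewrite memv_cap memvB ?mlie //; apply/killing_orthP => u uN.
rewrite killingC; apply: (form_basis0 killing_linearr (vbasisP N)) uN => i.
by rewrite killingDl killingNl killing_lie zE subrr.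
Qed.

(** [[m, M]] is orthogonal to the centralizer of [m]; what is also orthogonal to
    [N] is orthogonal to all of [M]. *)
Lemma tangent_complement_direct : directv ((ad m @: M) + (M :&: killing_orth N)).
Proof.
apply/directv_addP/eqP; rewrite -subv0; apply/subvP => w.
rewrite memv0 !memv_cap => /and3P[/memv_imgP[z zM ->] mzM mzO]; apply/eqP.
apply: ndM => // v; rewrite -{1}sumM => /memv_addP[v0 /memv_capP[_ v0m] [v1 v1N ->]].
by rewrite killingDr {1}adE bracket_orth // killingC (killing_orthP _ _ mzO) // addr0.
Qed.

End TransverseComplement.

(** * The transverse Poisson structure *)

Section Gradient.
Context {R : realType} {g : lieAlgType R[i]}.
Implicit Types (M N : {vspace g}) (m y v w : g).

Lemma is_derive_affine (a c : R[i]) :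
  is_derive (0 : R[i]^o) (1 : R[i]^o) (fun t : R[i]^o => a + t * c : R[i]^o) c.
Proof.
have -> : (fun t : R[i]^o => a + t * c : R[i]^o) = (cst (a : R[i]^o) \+ (c \*: id))%R.
  by apply/funext => t /=; rewrite mulrC.
rewrite -[X in is_derive _ _ _ X](_ : 0 + c *: (1 : R[i]^o) = c); last first.
  by rewrite add0r [LHS]mulr1.
exact: is_deriveD.
Qed.

Lemma is_gradient_killing_coord M m d (W : d.-tuple g) i y :
  tnth W i \in M -> is_gradient M (killing_coord m W i) y (tnth W i).
Proof.
move=> WM; split=> // v vM.
rewrite (_ : (fun t => _) = fun t : R[i]^o =>
    killing (y - m) (tnth W i) + t * killing (tnth W i) v :> R[i]^o).
  exact: is_derive_affine.
apply/funext => t; rewrite /killing_coord addrAC [LHS]killingDl killingZl.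
by rewrite [killing v _]killingC.
Qed.

Lemma gradient_killing_coord M m d (W : d.-tuple g) i y :
  nondegenerate_on killing M -> tnth W i \in M ->
  gradient M (killing_coord m W i) y = tnth W i.
Proof.
move=> ndM WM; have gW := is_gradient_killing_coord m y WM.
rewrite /gradient; case: xgetP => [w _ [wM gw]|/(_ (tnth W i))]; last by case.
apply: (killing_inj ndM) => // v vM.
have := derive_val (is_derive := gw v vM).
by have -> := derive_val (is_derive := gW.2 v vM).
Qed.

Lemma poisson_mx_killing_coord M m d (W : d.-tuple g) y :
  nondegenerate_on killing M -> (forall i, tnth W i \in M) ->
  poisson_mx M (killing_coord m W) y = bracket_mx W W y.
Proof.
move=> ndM WM; apply/matrixP => i j.
by rewrite !mxE /lie_poisson !gradient_killing_coord.
Qed.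

Lemma linear_coordinates_killing_coord M m d (W : d.-tuple g) :
  nondegenerate_on killing M -> m \in M -> basis_of M W ->
  linear_coordinates M m (killing_coord m W).
Proof.
move=> ndM mM WM; split=> // [i|c].
  exists (linfun (killing (tnth W i) : g -> R[i]^o)) => y.
  by rewrite lfunE /= killingC.
have [z zM zE] := form_dual killing_linearl killing_linearr c WM ndM.
exists (z + m); split=> [|y [yM yE]].
  by rewrite memvD //; split=> // i; rewrite /killing_coord addrK.
apply/esym/eqP; rewrite -subr_eq -subr_eq0; apply/eqP.
apply: ndM => [|v vM]; first by rewrite !memvB.
apply: (form_basis0 killing_linearr WM) vM => i.
by rewrite killingDl killingNl zE -yE subrr.
Qed.

End Gradient.

Section Perturbation.
Context {R : realType}.

(** Factoring [C0] out leaves [1 + B] with the rows of [B] of l1-norm less than 1;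
    if [v (1 + B) = 0] then the l1-norm of [v = - v B] is at most that of [v] times
    the largest l1-norm of a row of [B], which forces [v = 0]. *)
Lemma unitmx_perturbation k l (C0 : 'M[R[i]]_l) (E : 'I_k -> 'M[R[i]]_l) :
  C0 \in unitmx -> exists2 eps : R, 0 < eps &
    forall a : 'I_k -> R[i], (forall i, `|a i| < eps%:C) ->
      C0 + \sum_i a i *: E i \in unitmx.
Proof.
move=> C0u; pose G i := E i *m invmx C0.
pose S : R[i] := \sum_i \sum_p \sum_q `|G i p q|.
have S0 : 0 <= S by do 3!apply: sumr_ge0 => ? _; exact: normr_ge0.
have ReS : (complex.Re S)%:C = S by rewrite RRe_real // ger0_real.
have ReS0 : 0 <= complex.Re S by rewrite -lecR ReS.
have lt0S : 0 < 1 + complex.Re S by rewrite ltr_pwDl.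
exists (1 + complex.Re S)^-1; first by rewrite invr_gt0.
move=> a a_lt; set eps := (_^-1) in a_lt.
have eps0 : 0 <= eps%:C by rewrite ler0c invr_ge0 ltW.
have epsS : eps%:C * S < 1.
  by rewrite -ReS -rmorphM /= -(rmorph1 (real_complex R)) ltcR mulrC
     ltr_pdivrMr ?mul1r // ltrDr.
pose B := \sum_i a i *: G i.
have -> : C0 + \sum_i a i *: E i = (1%:M + B) *m C0.
  rewrite mulmxDl mul1mx mulmx_suml; congr (_ + _); apply: eq_bigr => i _.
  by rewrite -scalemxAl /G mulmxKV.
rewrite unitmx_mul C0u andbT -row_free_unit -kermx_eq0; apply/rowV0P => v.
move=> /sub_kermxP; rewrite mulmxDr mulmx1 => /eqP; rewrite addr_eq0 => /eqP vB.
pose T := \sum_q `|v 0 q|.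
have T0 : 0 <= T by apply: sumr_ge0.
have rowB p : \sum_q `|B p q| <= eps%:C * S.
  have BE q : `|B p q| <= eps%:C * \sum_i `|G i p q|.
    rewrite summxE mulr_sumr (le_trans (ler_norm_sum _ _ _)) //.
    by apply: ler_sum => i _; rewrite mxE normrM ler_wpM2r // ltW.
  apply: le_trans (ler_sum _ (fun q _ => BE q)) _.
  rewrite -mulr_sumr ler_wpM2l // exchange_big /=; apply: ler_sum => i _.
  rewrite [X in _ <= X](bigD1 p) //= lerDl; do 2!apply: sumr_ge0 => ? _; exact: normr_ge0.
have TleT : T <= eps%:C * S * T.
  rewrite {1}/T; apply: (@le_trans _ _ (\sum_q \sum_p `|v 0 p| * `|B p q|)).
    apply: ler_sum => q _; rewrite vB !mxE normrN (le_trans (ler_norm_sum _ _ _)) //.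
    by apply: ler_sum => p _; rewrite -normrM -vB.
  rewrite exchange_big /= mulr_sumr; apply: ler_sum => p _.
  by rewrite -mulr_sumr mulrC ler_wpM2r.
have T_eq0 : T = 0.
  apply/eqP; rewrite eq_le T0 andbT.
  have : T * (1 - eps%:C * S) <= 0 by rewrite mulrBr mulr1 subr_le0 mulrC.
  by rewrite pmulr_lle0 // subr_gt0.
apply/rowP => q; rewrite mxE; apply/eqP; rewrite -normr_eq0.
move/eqP: T_eq0; rewrite psumr_eq0 // => /allP/(_ q).
by rewrite mem_index_enum => /(_ isT).
Qed.

End Perturbation.

Section TransversePoisson.
Context {R : realType} {g : lieAlgType R[i]}.
Implicit Types (M N : {vspace g}) (m y v w : g).

Lemma affine_spaceP m (U : {vspace g}) y :
  affine_space m U y <-> y - m \in U.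
Proof.
split=> [[u uU <-]|yU]; first by rewrite addrAC subrr add0r.
by exists (y - m) => //; rewrite addrC subrK.
Qed.

Lemma slice_coordinates M N m k l (Z : k.-tuple g) (X : l.-tuple g) :
  m \in M -> basis_of N X ->
  affine_space m (M :&: killing_orth N)%VS =
  [set y | y \in M /\ forall j : 'I_l, killing_coord m (cat_tuple Z X) (rshift k j) y = 0].
Proof.
move=> mM XN; apply/seteqP; split=> y.
  move=> /affine_spaceP; rewrite memv_cap => /andP[yM /killing_orthP yN].
  split=> [|j]; first by rewrite -(subrK m y) memvD.
  rewrite /killing_coord tnth_rshift killingC yN // (basis_mem XN) //.
  exact: mem_tnth.
move=> [yM y0]; apply/affine_spaceP; rewrite memv_cap memvB //=.
apply/killing_orthP => u uN; rewrite killingC.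
apply: (form_basis0 killing_linearr XN) uN => j.
by have := y0 j; rewrite /killing_coord tnth_rshift.
Qed.

Lemma bracket_mx_block k l (Z : k.-tuple g) (X : l.-tuple g) y :
  bracket_mx (cat_tuple Z X) (cat_tuple Z X) y =
  block_mx (bracket_mx Z Z y) (bracket_mx Z X y)
           (bracket_mx X Z y) (bracket_mx X X y).
Proof.
apply/matrixP => i j.
case: (split_ordP i) => i' ->; case: (split_ordP j) => j' ->.
- by rewrite block_mxEul !mxE !tnth_lshift.
- by rewrite block_mxEur !mxE tnth_lshift tnth_rshift.
- by rewrite block_mxEdl !mxE tnth_lshift tnth_rshift.
- by rewrite block_mxEdr !mxE !tnth_rshift.
Qed.

Lemma bracket_mxD d (X : d.-tuple g) y w :
  bracket_mx X X (y + w) = bracket_mx X X y + bracket_mx X X w.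
Proof. by apply/matrixP => i j; rewrite !mxE killingDl. Qed.

Lemma bracket_mx_sumZ d (X : d.-tuple g) k (a : 'I_k -> R[i]) (w : 'I_k -> g) :
  bracket_mx X X (\sum_i a i *: w i) = \sum_i a i *: bracket_mx X X (w i).
Proof.
apply/matrixP => p q; rewrite summxE mxE killing_suml; apply: eq_bigr => i _.
by rewrite !mxE killingZl.
Qed.

(** The Poisson matrix at [y] is the matrix of the products [<y | [., .]>] of the
    basis vectors.  On the slice [y] is an affine function of its first [k]
    coordinates, so the block [C] is a small perturbation of its value at [m]. *)
Lemma dirac_reduction M N m k l (Z : k.-tuple g) (X : l.-tuple g)
    (P : g -> 'M[R[i]]_k) :
  (lie_prod M M <= M)%VS -> m \in M -> nondegenerate_on killing M ->
  ((M :&: centralizer m) + N)%VS = M -> ((M :&: centralizer m) :&: N = 0)%VS ->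
  basis_of (M :&: centralizer m)%VS Z -> basis_of N X ->
  (forall y, affine_space m (M :&: killing_orth N)%VS y ->
    bracket_mx X X y \in unitmx ->
    P y = bracket_mx Z Z y +
          bracket_mx Z X y *m invmx (bracket_mx X X y) *m (bracket_mx Z X y)^T) ->
  transverse_poisson_mx M m (affine_space m (M :&: killing_orth N)%VS)
    (killing_coord m (cat_tuple Z X)) P.
Proof.
move=> MM mM ndM sumM dirM ZP XP PE.
have WM : basis_of M (cat_tuple Z X).
  by rewrite -sumM; apply: cat_basis => //; apply/directv_addP.
have WinM i : tnth (cat_tuple Z X) i \in M.
  by rewrite (basis_mem WM) // mem_tnth.
split; first exact: linear_coordinates_killing_coord.
  exact: slice_coordinates.
pose q := killing_coord m (cat_tuple Z X).
have /choice[w wE] (i : 'I_k) : exists w, w \in M /\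
    forall j, killing w (tnth (cat_tuple Z X) j) = (j == lshift l i)%:R.
  have [w wM wE] := form_dual killing_linearl killing_linearr
    (fun j => (j == lshift l i)%:R) WM ndM.
  by exists w.
have Cu := bracket_mx_unit MM mM ndM sumM dirM XP.
have [eps eps0 epsE] := unitmx_perturbation (fun i => bracket_mx X X (w i)) Cu.
exists eps => // y yN y_lt /=; have := yN.
rewrite (slice_coordinates Z mM XP) => -[yM y0].
(* The w i are the vectors of the Killing-dual basis of M that are dual to Z. *)
have yE : y = m + \sum_i q (lshift l i) y *: w i.
  apply/eqP; rewrite addrC -subr_eq -subr_eq0; apply/eqP.
  apply: ndM => [|v vM].
    by rewrite !memvB // memv_suml // => i _; rewrite memvZ //; have [] := wE i.
  apply: (form_basis0 killing_linearr WM) vM => j.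
  rewrite killingDl killingNl killing_suml -[killing (y - m) _]/(q j y).
  rewrite (eq_bigr (fun i => q (lshift l i) y * (j == lshift l i)%:R)); last first.
    by move=> i _; rewrite killingZl (wE i).2.
  case: (split_ordP j) => j' ->.
    rewrite (bigD1 j') //= eqxx mulr1 big1 ?addr0 ?subrr // => i ij.
    by rewrite (inj_eq (@lshift_inj _ _)) eq_sym (negPf ij) mulr0.
  rewrite [q _ y](y0 j') sub0r big1 ?oppr0 // => i _.
  by rewrite eq_rlshift mulr0.
have Xu : bracket_mx X X y \in unitmx.
  by rewrite yE bracket_mxD bracket_mx_sumZ; exact: epsE.
rewrite poisson_mx_killing_coord // bracket_mx_block.
by rewrite block_mxKul block_mxKur block_mxKdr PE.
Qed.

End TransversePoisson.

(** * Complex sequences *)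

Section ComplexSequences.
Context {R : realType}.
Implicit Types (z w : R[i]) (u : nat -> R[i]).

(** The modulus as an element of [R]. *)
Definition cabs z : R := complex.Re `|z|.

Lemma cabsE z : (cabs z)%:C = `|z|.
Proof. by rewrite /cabs RRe_real // normr_real. Qed.

Lemma cabs_ge0 z : 0 <= cabs z.
Proof. by rewrite -ler0c cabsE. Qed.

Lemma cabsD z w : cabs (z + w) <= cabs z + cabs w.
Proof. by rewrite -lecR rmorphD /= !cabsE ler_normD. Qed.

Lemma cabsM z w : cabs (z * w) = cabs z * cabs w.
Proof. by apply: complexI; rewrite rmorphM /= !cabsE normrM. Qed.

Lemma cabsN z : cabs (- z) = cabs z.
Proof. by apply: complexI; rewrite !cabsE normrN. Qed.

Lemma cabs0 : cabs 0 = 0.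
Proof. by apply: complexI; rewrite cabsE normr0. Qed.

Lemma cabs_real (x : R) : cabs x%:C = `|x|.
Proof.
by apply: complexI; rewrite cabsE normc_def /= expr0n /= addr0 sqrtr_sqr.
Qed.

Lemma cabs_eq0 z : cabs z = 0 -> z = 0.
Proof. by move=> z0; apply/eqP; rewrite -normr_eq0 -cabsE z0. Qed.

Lemma cabs_Re z : `|complex.Re z| <= cabs z.
Proof. by rewrite -lecR cabsE normc_ge_Re. Qed.

Lemma cabs_Im z : `|complex.Im z| <= cabs z.
Proof.
have := cabs_Re (z * 'i%C); rewrite ReiNIm normrN cabsM.
suff -> : cabs 'i%C = 1 by rewrite mulr1.
by apply: complexI; rewrite cabsE normc_def /= expr0n expr1n add0r sqrtr1.
Qed.

Lemma cabs_Re_Im z : cabs z <= `|complex.Re z| + `|complex.Im z|.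
Proof.
rewrite {1}[z]complexE (le_trans (cabsD _ _)) // cabsM !cabs_real lerD2l.
suff -> : cabs 'i%C = 1 by rewrite mul1r.
by apply: complexI; rewrite cabsE normc_def /= expr0n expr1n add0r sqrtr1.
Qed.

Lemma cvg_cabsP u z :
  ((fun n => u n : R[i]^o) @ \oo --> (z : R[i]^o)) <->
  ((fun n => cabs (z - u n)) @ \oo --> (0 : R)).
Proof.
split=> [/cvgrPdist_lt uz | /cvgrPdist_lt uz]; apply/cvgrPdist_lt => e e0.
  have /uz : (0 : R[i]) < e%:C by rewrite ltcR.
  apply: filterS => n; rewrite -[`|_|](cabsE (z - u n)) ltcR.
  by rewrite sub0r normrN ger0_norm ?cabs_ge0.
have eE : (complex.Re e)%:C = e by rewrite RRe_real // gtr0_real.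
have /uz : 0 < complex.Re e by rewrite -ltcR eE.
apply: filterS => n; rewrite sub0r normrN ger0_norm ?cabs_ge0 //.
by rewrite -ltcR cabsE eE.
Qed.

Lemma cvg_cabs_squeeze u z (t : nat -> R) :
  (forall n, cabs (z - u n) <= t n) -> t @ \oo --> (0 : R) ->
  (fun n => u n : R[i]^o) @ \oo --> (z : R[i]^o).
Proof.
move=> uzt t0; apply/cvg_cabsP.
apply: (@squeeze_cvgr _ _ _ _ (fun=> 0) t) => //; last exact: cvg_cst.
by apply: nearW => n; rewrite cabs_ge0 uzt.
Qed.

Lemma cvg_complex u z :
  (fun n => complex.Re (u n)) @ \oo --> complex.Re z ->
  (fun n => complex.Im (u n)) @ \oo --> complex.Im z ->
  (fun n => u n : R[i]^o) @ \oo --> (z : R[i]^o).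
Proof.
move=> uRe uIm.
apply: (@cvg_cabs_squeeze _ _ (fun n => `|complex.Re z - complex.Re (u n)| +
  `|complex.Im z - complex.Im (u n)|)) => [n|].
  by have := cabs_Re_Im (z - u n); case: (z) => ? ?; case: (u n).
rewrite -[0 : R]addr0; apply: cvgD; rewrite -(normr0 R); apply: cvg_norm.
  by rewrite -(subrr (complex.Re z)); apply: cvgB => //; exact: cvg_cst.
by rewrite -(subrr (complex.Im z)); apply: cvgB => //; exact: cvg_cst.
Qed.

(** Convergence is obtained from the completeness of [R] on real and imaginary
    parts. *)
Lemma is_cvg_series_dominated u (c M : R) : 0 <= c -> 0 <= M ->
  (forall k, cabs (u k) <= c * exp_coeff M k) ->
  cvgn (series (fun k => u k : R[i]^o)).
Proof.
move=> c0 M0 uM.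
have dom (v : nat -> R) : (forall k, `|v k| <= cabs (u k)) -> cvgn (series v).
  move=> vu; apply: normed_cvg.
  apply: (@series_le_cvg _ _ (c *: exp_coeff M)) => [n|n|n|].
  - exact: normr_ge0.
  - by rewrite mulr_ge0 // exp_coeff_ge0.
  - exact: le_trans (vu n) (uM n).
  - rewrite (_ : series _ = c *: series (exp_coeff M)).
      apply: is_cvgZl_tmp; exact: is_cvg_series_exp_coeff.
    by apply/funext => n; rewrite /series /= -mulr_sumr.
have /cvg_ex[a aE] := dom (fun k => complex.Re (u k)) (fun k => cabs_Re (u k)).
have /cvg_ex[b bE] := dom (fun k => complex.Im (u k)) (fun k => cabs_Im (u k)).
apply/cvg_ex; exists (a +i* b)%C; apply: cvg_complex.
  rewrite (_ : (fun n => _) = series (fun k => complex.Re (u k))) //.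
  apply/funext => n; rewrite /series /=.
  by elim/big_rec2: _ => //= k x [y y'] _ <-; case: (u k).
rewrite (_ : (fun n => _) = series (fun k => complex.Im (u k))) //.
apply/funext => n; rewrite /series /=.
by elim/big_rec2: _ => //= k x [y y'] _ <-; case: (u k).
Qed.

Lemma cvg_cabs_le u z (B : R) N :
  (fun n => u n : R[i]^o) @ \oo --> (z : R[i]^o) ->
  (forall n, (N <= n)%N -> cabs (u n) <= B) -> cabs z <= B.
Proof.
move=> /cvg_cabsP/cvgrPdist_lt uz uB; apply/ler_addgt0Pr => e e0.
have [n [Nn nz]] : exists n, (N <= n)%N /\ `|0 - cabs (z - u n)| < e.
  have [n0 _ nz] := uz e e0.
  by exists (maxn N n0); rewrite leq_maxl; split=> //; apply: nz; rewrite /= leq_maxr.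
rewrite -(subrK (u n) z) (le_trans (cabsD _ _)) // addrC lerD ?uB //.
by move: nz; rewrite sub0r normrN ger0_norm ?cabs_ge0 // => /ltW.
Qed.

End ComplexSequences.

(** * The exponential of an operator *)

Section Exponential.
Context {R : realType} {V : lieAlgType R[i]}.
Implicit Types (u v w : V) (f D : 'End(V)).

Let b := vbasis {:V}.
Let bF : free b := basis_free (vbasisP _).

(** Coordinatewise convergence, the notion in which the exponential is defined. *)
Definition vcvg (u : nat -> V) (l : V) := forall i,
  (fun n => coord b i (u n) : R[i]^o) @ \oo --> (coord b i l : R[i]^o).

Definition vnorm v : R := \sum_i cabs (coord b i v).

Lemma vcvg_unique (u : nat -> V) l l' : vcvg u l -> vcvg u l' -> l = l'.
Proof.
move=> ul ul'; rewrite (coord_vbasis (memvf l)) (coord_vbasis (memvf l')).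
apply: eq_bigr => i _; congr (_ *: _).
exact: (norm_cvg_unique (ul i) (ul' i)).
Qed.

Lemma vcvgD (u w : nat -> V) l m : vcvg u l -> vcvg w m ->
  vcvg (fun n => u n + w n) (l + m).
Proof.
move=> ul wm i; rewrite raddfD /=.
rewrite (_ : (fun n => _) = (fun n => coord b i (u n) : R[i]^o) \+
  (fun n => coord b i (w n) : R[i]^o)); first exact: cvgD.
by apply/funext => n; rewrite raddfD.
Qed.

Lemma vcvgZ (a : R[i]) (u : nat -> V) l : vcvg u l ->
  vcvg (fun n => a *: u n) (a *: l).
Proof.
move=> ul i; rewrite linearZ /=.
rewrite (_ : (fun n => _) = a \*: (fun n => coord b i (u n) : R[i]^o)).
  exact: cvgZl_tmp.
by apply/funext => n; rewrite linearZ.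
Qed.

Lemma vcvg_cst l : vcvg (fun=> l) l.
Proof. by move=> i; exact: cvg_cst. Qed.

Lemma vcvgB (u w : nat -> V) l m : vcvg u l -> vcvg w m ->
  vcvg (fun n => u n - w n) (l - m).
Proof.
move=> ul wm; have := vcvgD ul (@vcvgZ (-1) _ _ wm); rewrite scaleN1r.
by congr (vcvg _ _); apply/funext => n; rewrite scaleN1r.
Qed.

Arguments vcvg_cst : clear implicits.

Lemma vnorm_ge0 v : 0 <= vnorm v.
Proof. by apply: sumr_ge0 => i _; exact: cabs_ge0. Qed.

Lemma vnormD u v : vnorm (u + v) <= vnorm u + vnorm v.
Proof.
by rewrite -big_split; apply: ler_sum => i _; rewrite raddfD cabsD.
Qed.

Lemma vnormZ (a : R[i]) v : vnorm (a *: v) = cabs a * vnorm v.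
Proof. by rewrite mulr_sumr; apply: eq_bigr => i _; rewrite linearZ cabsM. Qed.

Lemma vnormN v : vnorm (- v) = vnorm v.
Proof. by apply: eq_bigr => i _; rewrite raddfN cabsN. Qed.

Lemma vnorm0 : vnorm 0 = 0.
Proof. by apply: big1 => i _; rewrite raddf0 cabs0. Qed.

Lemma vnorm_sum I (r : seq I) (P : pred I) (F : I -> V) :
  vnorm (\sum_(i <- r | P i) F i) <= \sum_(i <- r | P i) vnorm (F i).
Proof.
elim/big_rec2: _ => [|i x z _ zx]; first by rewrite vnorm0.
by rewrite (le_trans (vnormD _ _)) // lerD2l.
Qed.

Lemma cabs_coord i v : cabs (coord b i v) <= vnorm v.
Proof.
by rewrite /vnorm (bigD1 i) //= lerDl sumr_ge0 // => j _; exact: cabs_ge0.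
Qed.

Lemma vnorm_eq0 v : vnorm v = 0 -> v = 0.
Proof.
move=> v0; rewrite (coord_vbasis (memvf v)) big1 // => i _.
rewrite [X in X *: _]cabs_eq0 ?scale0r //; apply/eqP.
by rewrite eq_le cabs_ge0 andbT -v0 cabs_coord.
Qed.

Lemma vnorm_lfun f : exists2 M : R, 0 <= M & forall v, vnorm (f v) <= M * vnorm v.
Proof.
exists (\sum_(j < \dim {:V}) vnorm (f b`_j)).
  by apply: sumr_ge0 => j _; exact: vnorm_ge0.
move=> v; rewrite {1}(coord_vbasis (memvf v)) linear_sum.
rewrite (le_trans (vnorm_sum _ _ _)) // mulr_suml; apply: ler_sum => j _.
by rewrite linearZ vnormZ mulrC ler_wpM2l ?vnorm_ge0 ?cabs_coord.
Qed.

(** Used to discard second-order terms: divide by [t] and let [t] tend to 0. *)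
Lemma vnorm_small v (K : R) :
  (forall t, 0 < t -> t <= 1 -> t * vnorm v <= t ^+ 2 * K) -> v = 0.
Proof.
move=> vK; apply: vnorm_eq0; apply/eqP; rewrite eq_le vnorm_ge0 andbT.
apply/ler_addgt0Pr => e e0; rewrite add0r.
have K1 : 0 < `|K| + 1 by rewrite ltr_wpDl.
pose t := Num.min 1 (e / (`|K| + 1)).
have t0 : 0 < t by rewrite lt_min ltr01 divr_gt0.
have t1 : t <= 1 by rewrite ge_min lexx.
have := vK t t0 t1; rewrite expr2 -mulrA ler_pM2l // => /le_trans; apply.
rewrite (@le_trans _ _ (t * (`|K| + 1))) //.
  by apply: ler_wpM2l; rewrite ?(ltW t0) // (le_trans (ler_norm K)) // lerDl.
by rewrite -ler_pdivlMr // ge_min lexx orbT.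
Qed.

Definition exp_partial D v n : V := \sum_(0 <= k < n) k`!%:R^-1 *: iter k D v.

Lemma vnorm_exp_term D : exists2 M : R, 0 <= M &
  forall k v, vnorm (k`!%:R^-1 *: iter k D v) <= vnorm v * exp_coeff M k.
Proof.
have [M M0 DM] := vnorm_lfun D; exists M => // k v.
have -> : (k`!%:R^-1 : R[i]) = (k`!%:R^-1 : R)%:C by rewrite fmorphV rmorph_nat.
rewrite vnormZ cabs_real ger0_norm ?invr_ge0 //.
rewrite /exp_coeff /= mulrA [leRHS]mulrC ler_wpM2l ?invr_ge0 //.
elim: k => [|k IHk]; first by rewrite mulr1.
by rewrite iterS (le_trans (DM _)) // exprS mulrCA ler_wpM2l.
Qed.

Let exp_limit D v : V := \sum_(i < \dim {:V})
    (lim (series (fun k : nat =>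
       (k`!%:R^-1 * coord (vbasis {:V}) i (iter k D v) : R[i]^o)) @ \oo) : R[i])
      *: (vbasis {:V})`_i.

Let exp_limitP D v : vcvg (exp_partial D v) (exp_limit D v).
Proof.
move=> i; rewrite /exp_limit coord_sum_free //.
have coordE : (fun n => coord b i (exp_partial D v n) : R[i]^o) =
    series (fun k : nat => (k`!%:R^-1 * coord b i (iter k D v) : R[i]^o)).
  apply/funext => n; rewrite /exp_partial linear_sum /series /=.
  by apply: eq_bigr => k _; rewrite linearZ.
rewrite coordE; have [M M0 DM] := vnorm_exp_term D.
apply: (@is_cvg_series_dominated _ _ (vnorm v) M) => // [|k].
  exact: vnorm_ge0.
apply: le_trans (DM k v); apply: le_trans (cabs_coord i _).
by rewrite linearZ.
Qed.

Arguments exp_limitP : clear implicits.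

(** The limits that define the exponential exist, the coordinates of the terms being
    dominated by a real exponential series; linearity of the limit in [v] is what
    gives the values of the linear map built from it. *)
Lemma lfun_expP D v : vcvg (exp_partial D v) (lfun_exp D v).
Proof.
have lin : linear (exp_limit D).
  move=> a u w; apply: (vcvg_unique (exp_limitP D (a *: u + w))).
  rewrite (_ : exp_partial D _ = fun n => a *: exp_partial D u n + exp_partial D w n).
    by apply: vcvgD; [apply: vcvgZ|]; exact: exp_limitP.
  apply/funext => n; rewrite /exp_partial scaler_sumr -big_split /=.
  apply: eq_bigr => k _; rewrite scalerA mulrC -scalerA -scalerDr.
  congr (_ *: _); elim: k => //= k ->.
  by rewrite linearP.
pose L : {linear V -> V} := HB.pack (exp_limit D)
  (GRing.isLinear.Build R[i] V V _ _ lin).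
have -> : lfun_exp D v = exp_limit D v by exact: (lfunE L).
exact: exp_limitP.
Qed.

Arguments lfun_expP : clear implicits.

Lemma iter_lfunZ (a : R[i]) D k v :
  iter k (a *: D) v = a ^+ k *: iter k D v.
Proof.
elim: k => [|k /= ->]; first by rewrite scale1r.
by rewrite scale_lfunE linearZ scalerA exprS.
Qed.

Lemma vcvg_coord_le (u : nat -> V) l (B : R) N : vcvg u l ->
  (forall n, (N <= n)%N -> vnorm (u n) <= B) ->
  forall i, cabs (coord b i l) <= B.
Proof.
move=> ul uB i; apply: (cvg_cabs_le (ul i)) => n /uB.
exact: le_trans (cabs_coord _ _).
Qed.

Lemma lfun_exp_fixed D v : D v = 0 -> lfun_exp D v = v.
Proof.
move=> Dv; apply/eqP; rewrite -subr_eq0; apply/eqP/vnorm_eq0.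
apply/eqP; rewrite eq_le vnorm_ge0 andbT; apply: sumr_le0 => i _.
apply: (vcvg_coord_le (vcvgB (lfun_expP D v) (vcvg_cst v)) (N := 1%N)) => n n1.
rewrite /exp_partial big_ltn //= fact0 invr1 scale1r big_nat big1 ?addr0.
  by rewrite subrr vnorm0.
case=> // k _; suff -> : iter k.+1 D v = 0 by rewrite scaler0.
by elim: k => //= k ->; rewrite linear0.
Qed.

(** The terms of order at least 2 are dominated by [t ^+ 2] times a real
    exponential series. *)
Lemma lfun_exp_expansion D v : exists2 K : R, 0 <= K & forall t : R, 0 <= t -> t <= 1 ->
  vnorm (lfun_exp (t%:C *: D) v - v - t%:C *: D v) <= t ^+ 2 * K.
Proof.
have [M M0 DM] := vnorm_exp_term D.
pose K1 := vnorm v * expR M.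
have K10 : 0 <= K1 by rewrite mulr_ge0 ?vnorm_ge0 ?expR_ge0.
exists ((\dim {:V})%:R * K1); first by rewrite mulr_ge0.
move=> t t0 t1.
rewrite {1}/vnorm (_ : t ^+ 2 * (_ * K1) = \sum_(i < \dim {:V}) t ^+ 2 * K1); last first.
  by rewrite sumr_const card_ord -[RHS]mulr_natl mulrCA.
apply: ler_sum => i _; move: i.
apply: (vcvg_coord_le (vcvgB (vcvgB (lfun_expP (t%:C *: D) v) (vcvg_cst v))
  (vcvg_cst (t%:C *: D v))) (N := 2%N)) => n n2.
rewrite /exp_partial big_ltn ?(ltn_trans _ n2) // big_ltn //=.
rewrite (factS 0) fact0 muln1 invr1 !scale1r scale_lfunE.
rewrite [v + _]addrC addrK [_ + (\sum_(_ <= _ < _) _)]addrC addrK.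
apply: le_trans (vnorm_sum _ _ _) _.
apply: (@le_trans _ _ (\sum_(2 <= k < n) t ^+ 2 * (vnorm v * exp_coeff M k))).
  rewrite big_nat [leRHS]big_nat; apply: ler_sum => k /andP[k2 _].
  rewrite iter_lfunZ scalerA mulrC -scalerA vnormZ.
  rewrite -rmorphXn cabs_real ger0_norm ?exprn_ge0 //.
  by rewrite ler_pM ?vnorm_ge0 ?exprn_ge0 // ler_wiXn2l.
rewrite -!mulr_sumr !ler_wpM2l ?exprn_ge0 ?vnorm_ge0 //.
apply: le_trans (_ : series (exp_coeff M) n <= _).
  rewrite /series /= [leRHS](big_cat_nat (n := 2)) //= lerDr.
  by apply: sumr_ge0 => k _; exact: exp_coeff_ge0.
apply: nondecreasing_cvgn_le; last exact: is_cvg_series_exp_coeff.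
by apply: nondecreasing_series => k _ _; exact: exp_coeff_ge0.
Qed.

End Exponential.

Arguments vcvg_cst {R V} l i.
Arguments lfun_expP {R V} D v i.

(** * Automorphisms of a Lie algebra and its derivations *)

Section CauchyProduct.

(** The square of partial sums minus the partial sum of the Cauchy product is what
    lies beyond the antidiagonal of the square. *)
Lemma cauchy_product_remainder (T : zmodType) (F : nat -> nat -> T) n :
  \sum_(0 <= i < n) \sum_(0 <= j < n) F i j -
  \sum_(0 <= k < n) \sum_(0 <= i < k.+1) F i (k - i)%N =
  \sum_(0 <= i < n) \sum_(n - i <= j < n) F i j.
Proof.
have -> : \sum_(0 <= k < n) \sum_(0 <= i < k.+1) F i (k - i)%N =
    \sum_(0 <= i < n) \sum_(0 <= j < n - i) F i j.
  elim: n => [|n IHn]; first by rewrite !big_geq.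
  rewrite big_nat_recr //= IHn [RHS]big_nat_recr //= subSnn big_nat1.
  rewrite [X in _ + X = _]big_nat_recr //= subnn addrA; congr (_ + _).
  rewrite -big_split big_nat [RHS]big_nat; apply: eq_bigr => i /andP[_ lt_in].
  by rewrite subSn ?(ltnW lt_in) // [RHS]big_nat_recr.
rewrite -sumrB; apply: eq_bigr => i _.
rewrite (@big_cat_nat _ _ _ (n - i)%N 0%N n) //= ?leq_subr //.
by rewrite [LHS]addrC addKr.
Qed.

Lemma exp_coeff_convolution (R : realType) (M : R) k :
  \sum_(0 <= i < k.+1) exp_coeff M i * exp_coeff M (k - i)%N = exp_coeff (M + M) k.
Proof.
rewrite /exp_coeff /= exprDn big_mkord mulr_suml; apply: eq_bigr => i _.
have ik : (i <= k)%N by rewrite -ltnS.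
have fact_unit m : (m`!%:R : R) != 0 by rewrite pnatr_eq0 -lt0n fact_gt0.
rewrite -mulr_natr -(bin_fact ik) !natrM.
have bin_neq0 : ('C(k, i)%:R : R) != 0 by rewrite pnatr_eq0 -lt0n bin_gt0.
by field; rewrite !fact_unit bin_neq0.
Qed.

(** The remainder is the difference of the partial sums of [expR M * expR M] and of
    [expR (M + M)]. *)
Lemma cvg_exp_coeff_remainder (R : realType) (M : R) :
  (fun n => \sum_(0 <= i < n) \sum_(n - i <= j < n) exp_coeff M i * exp_coeff M j)
    @ \oo --> (0 : R).
Proof.
rewrite (_ : (fun n => _) = fun n => series (exp_coeff M) n * series (exp_coeff M) n -
    series (exp_coeff (M + M)) n).
  rewrite -(subrr (expR (M + M))) {1}expRD.
  by apply: cvgB; [apply: cvgM|]; exact: is_cvg_series_exp_coeff.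
apply/funext => n; rewrite -cauchy_product_remainder; congr (_ - _).
  by rewrite /series /= mulr_suml; apply: eq_bigr => i _; rewrite mulr_sumr.
by apply: eq_bigr => k _; rewrite exp_coeff_convolution.
Qed.

End CauchyProduct.

Section Automorphisms.
Context {R : realType} {g : lieAlgType R[i]}.
Implicit Types (x y s u v w : g) (D h : 'End(g)).

Let b := vbasis {:g}.

Definition lie_automorphism h := forall u v, h (lie u v) = lie (h u) (h v).

Lemma lie_basis u v : lie u v =
  \sum_j \sum_k (coord b j u * coord b k v) *: lie b`_j b`_k.
Proof.
rewrite {1}(coord_vbasis (memvf u)) lie_suml; apply: eq_bigr => j _.
rewrite {1}(coord_vbasis (memvf v)) lie_sumr; apply: eq_bigr => k _.
by rewrite lieZl lieZr scalerA.
Qed.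

Lemma vnorm_lie : exists2 K : R, 0 <= K &
  forall u v, vnorm (lie u v) <= K * (vnorm u * vnorm v).
Proof.
exists (\sum_(j < \dim {:g}) \sum_(k < \dim {:g}) vnorm (lie b`_j b`_k)).
  by do 2!apply: sumr_ge0 => ? _; exact: vnorm_ge0.
move=> u v; rewrite {1}lie_basis (le_trans (vnorm_sum _ _ _)) // mulr_suml.
apply: ler_sum => j _; rewrite (le_trans (vnorm_sum _ _ _)) // mulr_suml.
apply: ler_sum => k _; rewrite vnormZ mulrC ler_wpM2l ?vnorm_ge0 //.
by rewrite cabsM ler_pM ?cabs_ge0 // cabs_coord.
Qed.

Lemma vcvg_sum (I : Type) (r : seq I) (F : I -> nat -> g) (L : I -> g) :
  (forall i, vcvg (F i) (L i)) ->
  vcvg (fun n => \sum_(i <- r) F i n) (\sum_(i <- r) L i).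
Proof.
move=> FL; elim: r => [|i r IHr].
  rewrite big_nil; have := vcvg_cst (0 : g).
  by congr (vcvg _ _); apply/funext => n; rewrite big_nil.
rewrite big_cons; have := vcvgD (FL i) IHr.
by congr (vcvg _ _); apply/funext => n; rewrite big_cons.
Qed.

Lemma vcvg_lie (u w : nat -> g) l m : vcvg u l -> vcvg w m ->
  vcvg (fun n => lie (u n) (w n)) (lie l m).
Proof.
move=> ul wm.
have -> : (fun n => lie (u n) (w n)) = fun n =>
    \sum_j \sum_k (coord b j (u n) * coord b k (w n)) *: lie b`_j b`_k.
  by apply/funext => n; exact: lie_basis.
rewrite lie_basis; apply: vcvg_sum => j; apply: vcvg_sum => k i.
rewrite linearZ /= (_ : (fun n => _) = fun n =>
  ((coord b j (u n) * coord b k (w n)) * coord b i (lie b`_j b`_k) : R[i]^o)).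
  by apply: cvgMr_tmp; apply: cvgM; [exact: ul | exact: wm].
by apply/funext => n; rewrite linearZ.
Qed.

Lemma lie_derivation_leibniz D u v k : lie_derivation D ->
  k`!%:R^-1 *: iter k D (lie u v) =
  \sum_(0 <= i < k.+1) lie (i`!%:R^-1 *: iter i D u)
                           ((k - i)`!%:R^-1 *: iter (k - i) D v).
Proof.
move=> DD; pose U w i : g := i`!%:R^-1 *: iter i D w.
have DU w i : D (U w i) = i.+1%:R *: U w i.+1.
  by rewrite /U linearZ scalerA factS natrM invfM mulrA divff ?mul1r.
elim: k => [|k IHk].
  by rewrite big_nat1 subnn !fact0 invr1 !scale1r.
have k0 : k.+1%:R != 0 :> R[i] by rewrite pnatr_eq0.
apply: (scalerI k0); rewrite -[LHS](DU (lie u v) k) /U IHk linear_sum /=.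
rewrite scaler_sumr.
rewrite (eq_big_nat _ _ (F2 := fun i => i.+1%:R *: lie (U u i.+1) (U v (k - i)%N) +
    (k.+1 - i)%:R *: lie (U u i) (U v (k.+1 - i)%N))); last first.
  by move=> i /andP[_ ik]; rewrite DD !DU lieZl lieZr subSn.
rewrite big_split /=.
rewrite [X in X + _](_ : _ = \sum_(0 <= i < k.+2)
    i%:R *: lie (U u i) (U v (k.+1 - i)%N)); last first.
  by rewrite [RHS]big_nat_recl //= scale0r add0r.
rewrite [X in _ + X](_ : _ = \sum_(0 <= i < k.+2)
    (k.+1 - i)%:R *: lie (U u i) (U v (k.+1 - i)%N)); last first.
  by rewrite [RHS]big_nat_recr //= subnn scale0r addr0.
rewrite -big_split /=; apply: eq_big_nat => i /andP[_ ik].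
by rewrite -scalerDl -natrD subnKC.
Qed.

(** By the Leibniz rule the exponential series of the bracket is the Cauchy product
    of the two exponential series, and the remainder of this product is dominated
    by that of a product of real exponential series. *)
Lemma lfun_exp_automorphism D : lie_derivation D -> lie_automorphism (lfun_exp D).
Proof.
move=> DD u v; apply/eqP; rewrite eq_sym -subr_eq0; apply/eqP.
apply: (vcvg_unique (vcvgB (vcvg_lie (lfun_expP D u) (lfun_expP D v))
  (lfun_expP D (lie u v)))).
have [M M0 DM] := vnorm_exp_term D; have [K K0 lieK] := vnorm_lie.
pose rem n := \sum_(0 <= i < n) \sum_(n - i <= j < n) exp_coeff M i * exp_coeff M j.
move=> i; apply: (@cvg_cabs_squeeze _ _ _
  (fun n => K * (vnorm u * vnorm v) * rem n)); last first.
  rewrite -[0 : R](mulr0 (K * (vnorm u * vnorm v))).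
  by apply: cvgMl_tmp; exact: cvg_exp_coeff_remainder.
move=> n; rewrite raddf0 sub0r cabsN (le_trans (cabs_coord _ _)) //.
rewrite /exp_partial.
under [X in _ - X]eq_bigr do rewrite lie_derivation_leibniz //.
rewrite lie_suml; under [X in X - _]eq_bigr do rewrite lie_sumr.
rewrite cauchy_product_remainder /rem.
rewrite (le_trans (vnorm_sum _ _ _)) // mulr_sumr; apply: ler_sum => p _.
rewrite (le_trans (vnorm_sum _ _ _)) // mulr_sumr; apply: ler_sum => q _.
rewrite (le_trans (lieK _ _)) // -mulrA ler_wpM2l // mulrACA.
by rewrite ler_pM ?vnorm_ge0.
Qed.

(** The terms of first order in [t] of [exp (t D) [u, v]] and of
    [[exp (t D) u, exp (t D) v]] are [D [u, v]] and [[D u, v] + [u, D v]]; all the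
    others are of order at least 2. *)
Lemma derivation_of_automorphisms D :
  (forall t : R, lie_automorphism (lfun_exp (t%:C *: D))) -> lie_derivation D.
Proof.
move=> autD u v; apply/eqP; rewrite -subr_eq0; apply/eqP.
have [Ku Ku0 expu] := lfun_exp_expansion D u.
have [Kv Kv0 expv] := lfun_exp_expansion D v.
have [Kl Kl0 expl] := lfun_exp_expansion D (lie u v).
have [K K0 lieK] := vnorm_lie.
pose nu := vnorm u + vnorm (D u); pose nv := vnorm v + vnorm (D v) + Kv.
apply: (vnorm_small (K := K * (vnorm (D u) * vnorm (D v)) + K * (Ku * nv) +
  K * (nu * Kv) + Kl)) => t t0 t1.
have {}expu := expu t (ltW t0) t1; have {}expv := expv t (ltW t0) t1.
have {}expl := expl t (ltW t0) t1; have {autD} := autD t u v.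
set E := lfun_exp _ in expu expv expl *.
set p := t%:C *: D u in expu; set q := t%:C *: D v in expv.
set ru := E u - u - p in expu; set rv := E v - v - q in expv.
set rl := E _ - _ - _ in expl => autE.
have uE : E u = u + p + ru by rewrite /ru -[E u - u - p]addrA -opprD [RHS]addrC subrK.
have vE : E v = v + q + rv by rewrite /rv -[E v - v - q]addrA -opprD [RHS]addrC subrK.
have vnormt w : vnorm (t%:C *: w) = t * vnorm w.
  by rewrite vnormZ cabs_real gtr0_norm.
have t_le1 w : t * vnorm w <= vnorm w by rewrite ler_piMl ?vnorm_ge0.
have t2_le1 (z : R) : 0 <= z -> t ^+ 2 * z <= z.
  by move=> z0; rewrite ler_piMl // exprn_ile1 // ltW.
have Ev : vnorm (E v) <= nv.
  rewrite vE (le_trans (vnormD _ _)) // lerD ?(le_trans expv) ?t2_le1 //.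
  by rewrite (le_trans (vnormD _ _)) // lerD // vnormt.
have uDu : vnorm (u + p) <= nu.
  by rewrite (le_trans (vnormD _ _)) // lerD // vnormt.
rewrite -vnormt.
have -> : t%:C *: (D (lie u v) - (lie (D u) v + lie u (D v))) =
    lie p q + lie ru (E v) + lie (u + p) rv - rl.
  have -> : rl = lie (E u) (E v) - lie u v - t%:C *: D (lie u v).
    by rewrite /rl autE.
  have -> : lie (E u) (E v) =
      lie u v + lie u q + (lie p v + lie p q) + lie (u + p) rv + lie ru (E v).
    rewrite {1}uE [LHS]lieDl {1}vE [lie (u + p) (v + q + rv)]lieDr.
    by rewrite [lie (u + p) (v + q)]lieDl [lie u (v + q)]lieDr [lie p (v + q)]lieDr.
  rewrite scalerBr scalerDr -lieZl -lieZr -/p -/q.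
  move: (lie u v) (lie p v) (lie u q) (lie p q) (lie ru _) (lie _ rv) (t%:C *: _).
  move=> a1 a2 a3 a4 a5 a6 a7.
  (* An identity in the underlying abelian group, checked on coordinates. *)
  by apply: (can_inj (rVofK (vbasisP _))); apply/rowP => i; rewrite !(raddfD, raddfN) !mxE; ring.
clearbody nu nv.
have t20 : 0 <= t ^+ 2 by rewrite exprn_ge0 // ltW.
rewrite !mulrDr; apply: le_trans (vnormD _ _) _; rewrite vnormN lerD //.
apply: le_trans (vnormD _ _) _; rewrite lerD //; last first.
  rewrite (le_trans (lieK _ _)) // [leRHS]mulrCA ler_wpM2l // [leRHS]mulrCA.
  by rewrite ler_pM ?vnorm_ge0.
apply: le_trans (vnormD _ _) _; rewrite lerD //; last first.
  rewrite (le_trans (lieK _ _)) // [leRHS]mulrCA ler_wpM2l // [leRHS]mulrA.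
  by rewrite ler_pM ?vnorm_ge0.
rewrite (le_trans (lieK _ _)) // [leRHS]mulrCA ler_wpM2l // /p /q !vnormt.
by rewrite mulrACA expr2.
Qed.

Lemma lie_derivation_ad x : lie_derivation (ad x).
Proof. by move=> u v; rewrite !adE lie_deriv. Qed.

Lemma adjoint_group_automorphism h : adjoint_group h -> lie_automorphism h.
Proof.
elim=> [u v|y {}h _ autoh u v]; first by rewrite !id_lfunE.
by rewrite !comp_lfunE autoh (lfun_exp_automorphism (lie_derivation_ad y)).
Qed.

Lemma adjoint_group_exp y : adjoint_group (lfun_exp (ad y)).
Proof. by rewrite -[lfun_exp _]comp_lfun1r; apply: adjoint_groupM; exact: adjoint_group1. Qed.

Lemma adZ (a : R[i]) y : a *: ad y = ad (a *: y).
Proof. by apply/lfunP => v; rewrite scale_lfunE !adE lieZl. Qed.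

(** One inclusion holds by definition of the adjoint group, since
    [exp (t ad y) = exp (ad (t y))]. *)
Lemma group_lie_adjoint D : nondegenerate_on (@killing _ g) {:g} ->
  group_lie adjoint_group D <-> exists y, D = ad y.
Proof.
move=> nd; split=> [GD|[y -> t]]; last by rewrite adZ; exact: adjoint_group_exp.
apply: derivation_inner => //; apply: derivation_of_automorphisms => t.
exact/adjoint_group_automorphism/GD.
Qed.

(** The first-order term of [exp (t ad y) s - s] is [[y, s]]. *)
Lemma group_lie_stabilizer s D : nondegenerate_on (@killing _ g) {:g} ->
  group_lie (adjoint_stabilizer s) D <-> exists2 y, y \in centralizer s & D = ad y.
Proof.
move=> nd; split=> [GD|[y ys -> t]]; last first.
  rewrite /adjoint_stabilizer /= adZ; split; first exact: adjoint_group_exp.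
  apply: lfun_exp_fixed; rewrite adE lieZl lieC.
  by move: ys; rewrite mem_centralizer => /eqP ->; rewrite oppr0 scaler0.
have [y DE] : exists y, D = ad y by apply/group_lie_adjoint => // t; have [] := GD t.
exists y => //; rewrite mem_centralizer lieC -adE -DE oppr_eq0; apply/eqP.
have [K K0 expK] := lfun_exp_expansion D s.
apply: (vnorm_small (K := K)) => t t0 t1.
have := expK t (ltW t0) t1; have [_ ->] := GD t.
by rewrite subrr sub0r vnormN vnormZ cabs_real gtr0_norm.
Qed.

End Automorphisms.

(** * The two slices *)

Section Slices.
Context {R : realType} {g : lieAlgType R[i]}.
Implicit Types (M : {vspace g}) (H : set 'End(g)) (m s x y u v : g).

Lemma orbit_tangent_ad M H m :
  (forall D, group_lie H D <-> exists2 y, y \in M & D = ad y) ->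
  [set` (ad m @: M)%VS] = orbit_tangent H m.
Proof.
move=> HM; apply/seteqP; split=> w /=.
  move=> /memv_imgP[v vM ->]; exists (ad (- v)).
    by apply/HM; exists (- v); rewrite ?memvN.
  by rewrite !adE lieNl -lieC.
move=> [D /HM[y yM ->] <-].
by rewrite adE lieC -lieNr -adE memv_img // memvN.
Qed.

Lemma bracket_mx_catr k l r (Z : k.-tuple g) (X : l.-tuple g) (Y : r.-tuple g) y :
  bracket_mx Z (cat_tuple X Y) y = row_mx (bracket_mx Z X y) (bracket_mx Z Y y).
Proof.
apply/matrixP => i j; case: (split_ordP j) => j' ->.
  by rewrite row_mxEl !mxE tnth_lshift.
by rewrite row_mxEr !mxE tnth_rshift.
Qed.

(** For [y] and [u] in [g(s)] also [[y, u]] is in [g(s)], so that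
    [<y | [u, v]> = <[y, u] | v>] vanishes when [v] is orthogonal to [g(s)]. *)
Lemma bracket_mx_centralizer_orth s k r (Z : k.-tuple g) (Y : r.-tuple g) y :
  y \in centralizer s -> {subset Z <= centralizer s} ->
  {subset Y <= killing_orth (centralizer s)} ->
  bracket_mx Z Y y = 0 /\ bracket_mx Y Z y = 0.
Proof.
move=> ys Zs Ys.
have ZY i j : killing y (lie (tnth Z i) (tnth Y j)) = 0.
  rewrite -killing_lie; apply: (killing_orthP _ _ (Ys _ (mem_tnth _ _))).
  exact: (subvP (lie_prod_centralizer s)) (memv_lie_prod ys (Zs _ (mem_tnth _ _))).
split; apply/matrixP => i j; rewrite !mxE ?ZY //.
by rewrite lieC killingNr ZY oppr0.
Qed.

Lemma schur_row_block (F : fieldType) k l r (A : 'M[F]_k) (B : 'M[F]_(k, l))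
    (C : 'M[F]_l) (C' : 'M[F]_r) :
  block_mx C 0 0 C' \in unitmx ->
  A + row_mx B 0 *m invmx (block_mx C 0 0 C') *m (row_mx B 0)^T =
  A + B *m invmx C *m B^T.
Proof.
move=> CC'; have := CC'; rewrite block_diag_mx_unit => /andP[Cu C'u].
rewrite invmx_block_diag // mul_row_block !mul0mx !mulmx0 !addr0.
by rewrite tr_row_mx mul_row_col trmx0 mulmx0 addr0.
Qed.

End Slices.

Theorem proposition2p1 (R : realType) (g : lieAlgType R[i])
    (g_ss : semisimple g) (x s e : g) (x_jc : jordan_chevalley x s e)
    (n_e : {vspace g})
    (n_e_add : (centralizer x + n_e)%VS = centralizer s)
    (n_e_direct : directv (centralizer x + n_e))
    (k l r : nat) (Z : k.-tuple g) (X : l.-tuple g) (Y : r.-tuple g)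
    (Z_basis : basis_of (centralizer x) Z)
    (X_basis : basis_of n_e X)
    (Y_basis : basis_of (killing_orth (centralizer s)) Y) :
  let n_s := killing_orth (centralizer s) in
  let n_perp := killing_orth (n_s + n_e)%VS in
  let N_x := affine_space x n_perp in
  let N := affine_space e n_perp in
  let q_x := killing_coord x (cat_tuple Z (cat_tuple X Y)) in
  let q := killing_coord e (cat_tuple Z X) in
  let P (n : g) :=
    bracket_mx Z Z n +
    bracket_mx Z X n *m invmx (bracket_mx X X n) *m (bracket_mx Z X n)^T in
  [/\ transverse_slice fullv adjoint_group x N_x /\
      transverse_slice (centralizer s) (adjoint_stabilizer s) e N,
      transverse_poisson_mx fullv x N_x q_x P,
      transverse_poisson_mx (centralizer s) e N q P,
      N_x = [set s + n | n in N]
    & forall n, N n ->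
        (forall i : 'I_k, q_x (lshift (l + r) i) (s + n) = q (lshift l i) n) /\
        P (s + n) = P n].

Proof.
move=> n_s n_perp N_x N q_x q P.
have [xE s_ss e_nil se0] := x_jc.
have nd : nondegenerate_on killing {:g}.
  by move=> u _ u0; apply: killing_nondegenerate => // v; apply: u0; exact: memvf.
have ndS := killing_centralizer_nondegenerate nd s_ss.
have SS := lie_prod_centralizer s.
have cxE := centralizer_jordan x_jc.
have Sns : (centralizer s + n_s)%VS = fullv := centralizer_orth s_ss.
have Sns0 : (centralizer s :&: n_s = 0)%VS := capv_killing_orth ndS.
have sub_ne : (n_e <= centralizer s)%VS by rewrite -n_e_add addvSr.
have sub_cx : (centralizer x <= centralizer s)%VS by rewrite cxE capvSl.
have sS : s \in centralizer s by rewrite mem_centralizer liexx.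
have eS : e \in centralizer s by rewrite mem_centralizer se0.
have perpE : n_perp = (centralizer s :&: killing_orth n_e)%VS.
  by rewrite /n_perp killing_orth_add killing_orth_orth.
have perpE_full : n_perp = ({:g} :&: n_perp)%VS by rewrite capfv.
have cx_ne0 : (centralizer x :&: n_e = 0)%VS by apply/directv_addP.
(* The complement of g(x) in g, and that of g(x) in g(s). *)
have sum_x : (({:g} :&: centralizer x) + (n_s + n_e))%VS = {:g}%VS.
  by rewrite capfv [(n_s + _)%VS]addvC addvA n_e_add.
have dir_x : (({:g} :&: centralizer x) :&: (n_s + n_e) = 0)%VS.
  apply/eqP; rewrite capfv -subv0; apply/subvP => v.
  rewrite memv_cap memv0 => /andP[vx /memv_addP[a a_ns [c c_ne vE]]].
  have a0 : a = 0.
    apply/eqP; rewrite -memv0 -Sns0 memv_cap a_ns andbT.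
    have -> : a = v - c by rewrite vE addrK.
    by rewrite memvB ?(subvP sub_cx _ vx) ?(subvP sub_ne _ c_ne).
  move: vx; rewrite vE a0 add0r => cx.
  by rewrite -memv0 -cx_ne0 memv_cap cx c_ne.
have sum_e : ((centralizer s :&: centralizer e) + n_e)%VS = centralizer s.
  by rewrite -cxE.
have dir_e : ((centralizer s :&: centralizer e) :&: n_e = 0)%VS by rewrite -cxE.
have XY_basis : basis_of (n_s + n_e)%VS (cat_tuple X Y).
  rewrite addvC; apply: cat_basis => //; apply/directv_addP/eqP.
  by rewrite -subv0 -Sns0 capvS.
have NxP y : N_x y <-> y - x \in n_perp := affine_spaceP x n_perp y.
have NP y : N y <-> y - e \in n_perp := affine_spaceP e n_perp y.
have Nx_sub y : N_x y -> y \in centralizer s.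
  move=> /NxP; rewrite perpE memv_cap => /andP[yS _].
  by rewrite -(subrK x y) memvD // xE memvD.
have XS : {subset X <= centralizer s}.
  by move=> v vX; apply: (subvP sub_ne); exact: (basis_mem X_basis).
have ZS : {subset Z <= centralizer s}.
  by move=> v vZ; apply: (subvP sub_cx); exact: (basis_mem Z_basis).
have YS : {subset Y <= killing_orth (centralizer s)}.
  by move=> v vY; exact: (basis_mem Y_basis).
split.
- split; split.
  + by move=> v _; exact: memvf.
  + exists (ad x @: {:g})%VS, n_perp; split=> //.
    * apply: orbit_tangent_ad => D; rewrite group_lie_adjoint //.
      by split=> [[y ->]|[y _ ->]]; exists y; rewrite ?memvf.
    * rewrite perpE_full tangent_complement_sum ?subvf ?memvf //.
    * rewrite perpE_full tangent_complement_direct ?subvf ?memvf //.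
  + move=> _ [h [Gh hs] <-] /=; rewrite mem_centralizer.
    by rewrite -{1}hs -(adjoint_group_automorphism Gh) se0 linear0.
  + exists (ad e @: centralizer s)%VS, n_perp; split=> //.
    * by apply: orbit_tangent_ad => D; exact: group_lie_stabilizer.
    * by rewrite perpE tangent_complement_sum.
    * by rewrite perpE tangent_complement_direct.
- rewrite /N_x perpE_full; apply: (dirac_reduction (subvf _) (memvf x) nd sum_x dir_x _ XY_basis).
    by rewrite capfv.
  rewrite -perpE_full => y /Nx_sub yS.
  have [ZY _] := bracket_mx_centralizer_orth yS ZS YS.
  have [XY YX] := bracket_mx_centralizer_orth yS XS YS.
  rewrite bracket_mx_block bracket_mx_catr XY YX ZY => Cu.
  by rewrite schur_row_block.
- rewrite /N perpE; apply: dirac_reduction => //.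
  by rewrite -cxE.
- apply/seteqP; split=> y.
    move=> /NxP yN; exists (y - s); last by rewrite addrC subrK.
    by apply/NP; rewrite -addrA -opprD -xE.
  by move=> [n /NP nN <-]; apply/NxP; rewrite xE opprD addrACA subrr add0r.
move=> n nN; split=> [i|].
  rewrite /q_x /q /killing_coord !tnth_lshift xE opprD addrACA subrr add0r //.
have s0 k1 k2 (W1 : k1.-tuple g) (W2 : k2.-tuple g) : {subset W1 <= centralizer s} ->
    bracket_mx W1 W2 (s + n) = bracket_mx W1 W2 n.
  move=> W1S; apply/matrixP => i j; rewrite !mxE killingDl -killing_lie.
  have := W1S _ (mem_tnth i W1); rewrite mem_centralizer => /eqP ->.
  by rewrite killing0l add0r.
by rewrite /P !s0.
Qed.
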